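(* Let $A\in\mathbb{R}^{m\times n}$, $b\in\mathbb{R}^m$, $m\ge n$, be normalized so that $\|A\|=\|b\|=1$, let $\kappa=\operatorname{cond}(A)$ and $x=\operatorname{argmin}_{x\in\mathbb{R}^n}\|b-Ax\|$. Let $\widehat R\in\mathbb{R}^{n\times n}$ be a numerically computed preconditioner, $\widehat x_0$ a numerically computed initialization, and let $\widehat x_1,\widehat x_2$ be produced from $\widehat R,\widehat x_0$ by the iterative refinement loop (described in the context) in floating point arithmetic with unit roundoff $u$. Assume the following. (A) Numerically full-rank: $\kappa u\ll 1$. (B) Non-pathological rounding errors: the output satisfies $\|\widehat x_2\|\gtrsim \|x\|+\kappa\left(\|x\|+\kappa\|b-Ax\|\right)u$. (C') Good preconditioner, initialization: the numerically computed preconditioner $\widehat R$ is triangular and the preconditioned matrix has condition number $\operatorname{cond}(A\widehat R^{-1})$ bounded by an absolute constant. The numerically computed initialization $\widehat x_0$ satisfies $\|A(x-\widehat x_0)\|\lesssim\|b-Ax\|+\|x\|u$. (D) Stability of inner solver: for every right-hand side $c$, the IterativeSolver subroutine satisfies $$\left\|\operatorname{fl}(\mathrm{IterativeSolver}(c))-(\widehat R^{-\top}A^\top A\widehat R^{-1})^{-1}c\right\|\lesssim \kappa u\cdot\|c\|.$$ Then the iterative refinement loop produces a strongly forward stable solution $x_1$ (computed as $\widehat x_1$) and a backward stable solution $x_2$ (computed as $\widehat x_2$).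
   Context: Norms: $\|\cdot\|$ is the Euclidean norm of a vector or the spectral norm of a matrix, $\|\cdot\|_{\rm F}$ the Frobenius norm, $\operatorname{cond}(B)=\sigma_{\max}(B)/\sigma_{\min}(B)$. Asymptotic notation: $a\lesssim b$ (equivalently $b\gtrsim a$) means $a\le c(m,n)\,b$ for a prefactor $c(m,n)$ that is a polynomial in $m$ and $n$ only. $a\ll b$ means $a\le b/c(m,n)$ for some sufficiently large polynomial $c(m,n)$; a hypothesis $a\ll b$ means that the result holds for a sufficiently large choice of this polynomial (which may depend on the polynomial prefactors in the other hypotheses). Floating point model: each arithmetic operation $\star\in\{+,-,\times,/\}$ is computed with $\operatorname{fl}(a\star b)=(a\star b)(1+\delta)$, $|\delta|\le u$, where $u$ is the unit roundoff. The numerically computed version of a quantity $f$ is denoted $\operatorname{fl}(f)$ or $\widehat f$. Expressions are evaluated in the sensible order (e.g. $AR^{-1}z$ as $A(R^{-1}z)$), and triangular solves are done by substitution. Iterative refinement loop, given preconditioner $R$ and initialization $x_0$: for $i=0,1$: set $c_i=R^{-\top}(A^\top(b-Ax_i))$; let $\delta y_i=\mathrm{IterativeSolver}(c_i)$, where IterativeSolver is a subroutine for solving $(R^{-\top}A^\top AR^{-1})\,\delta y=c_i$ given the routine $z\mapsto R^{-\top}(A^\top(A(R^{-1}z)))$; set $x_{i+1}=x_i+R^{-1}\delta y_i$. Backward stability: the backward error of $\widehat x$ is $\mathrm{BE}(\widehat x)=\min\{\|\Delta A\|_{\rm F}: \widehat x=\operatorname{argmin}_{z}\|b-(A+\Delta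 A)z\|\}$; $\widehat x$ is backward stable if $\mathrm{BE}(\widehat x)\le c\,\|A\|_{\rm F}u$ with $c$ a polynomial in $m$ and $n$. Strong forward stability: $\widehat x$ is strongly forward stable if for some $\varepsilon\lesssim u$ both $\|x-\widehat x\|\le 2.23\operatorname{cond}(A)\left(\|x\|+\frac{\operatorname{cond}(A)}{\|A\|}\|b-Ax\|\right)\varepsilon$ and $\|A(x-\widehat x)\|\le 2.23\left(\|A\|\|x\|+\operatorname{cond}(A)\|b-Ax\|\right)\varepsilon$.
   Formalization: The added assumption $\|A\widehat R^{-1}\|\lesssim 1$ fixes the scaling of the preconditioner; without it the claim fails, e.g. $m=n=1$, $A=b=1$, $\widehat R=u^2$, $\widehat x_0=1-u$, solver $c\mapsto(u^4+u)c$. *)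

(* Defs.v *)
From mathcomp Require Import all_boot all_order all_algebra.
From mathcomp Require Import all_classical all_reals.

Set Implicit Arguments.
Unset Strict Implicit.
Unset Printing Implicit Defensive.

Import Order.TTheory GRing.Theory Num.Theory.
Local Open Scope classical_set_scope.
Local Open Scope ring_scope.

Section Norms.
Variable R : realType.

Definition enorm n (v : 'cV[R]_n) : R := Num.sqrt (\sum_i v i 0 ^+ 2).

Definition frobenius m n (B : 'M[R]_(m, n)) : R :=
  Num.sqrt (\sum_i \sum_j B i j ^+ 2).

(* The singular values of a matrix with at least as many rows as columns, the
   only shape used below; for a wide matrix, B^T B would contribute zeros that
   are not counted as singular values. *)
Definition singular_value m n (B : 'M[R]_(m, n)) (s : R) : Prop :=
  0 <= s /\ eigenvalue (B^T *m B) (s ^+ 2).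

Definition sigma_max m n (B : 'M[R]_(m, n)) : R :=
  sup [set s | singular_value B s].

Definition sigma_min m n (B : 'M[R]_(m, n)) : R :=
  inf [set s | singular_value B s].

Definition spectral_norm m n (B : 'M[R]_(m, n)) : R := sigma_max B.

(* Meaningful only if 0 < sigma_min B: otherwise the condition number is
   infinite, whereas division by zero here returns 0. *)
Definition cond m n (B : 'M[R]_(m, n)) : R := sigma_max B / sigma_min B.

Definition triangular n (T : 'M[R]_n) : bool := is_trig_mx T || is_trig_mx T^T.

End Norms.

Section Asymptotics.
Variable R : realType.

Definition prefactor (c : nat -> nat -> R) : Prop :=
  (exists p : {poly {poly R}}, forall m n, c m n = p.[(m%:R)%:P].[n%:R]) /\
  (forall m n, (0 < m)%N -> (0 < n)%N -> 0 < c m n).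

End Asymptotics.

Section LeastSquares.
Variables (R : realType) (m n : nat).
Implicit Types (A : 'M[R]_(m, n)) (b : 'cV[R]_m) (x xh : 'cV[R]_n).

Definition lsq_solution A b x : Prop :=
  forall z, enorm (b - A *m x) <= enorm (b - A *m z).

(* The set of admissible perturbations is closed and contains -A, so that the
   infimum is a minimum. *)
Definition backward_error A b xh : R :=
  inf [set frobenius D | D in [set D | lsq_solution (A + D) b xh]].

Definition backward_stable (c u : R) A b xh : Prop :=
  backward_error A b xh <= c * frobenius A * u.

Definition strongly_forward_stable (c u : R) A b x xh : Prop :=
  exists eps : R, [/\ 0 <= eps <= c * u,
    enorm (x - xh) <= 223 / 100 * cond A *
      (enorm x + cond A / spectral_norm A * enorm (b - A *m x)) * eps &
    enorm (A *m (x - xh)) <= 223 / 100 *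
      (spectral_norm A * enorm x + cond A * enorm (b - A *m x)) * eps].

End LeastSquares.

(* Floating point computations are relations between exact inputs and possible
   outputs, so that each operation may commit any rounding error allowed by the
   model. *)
Section FloatingPoint.
Variables (R : realType) (u : R).

Definition fl (exact computed : R) : Prop :=
  exists2 delta : R, `|delta| <= u & computed = exact * (1 + delta).

(* Sum of a list, in any order and with any parenthesization. The two operands
   of an addition are nonempty sums, so n terms need n - 1 additions. *)
Inductive fl_sum : seq R -> R -> Prop :=
| fl_sum0 : fl_sum [::] 0
| fl_sum1 a : fl_sum [:: a] a
| fl_sum_perm s t v : perm_eq s t -> fl_sum s v -> fl_sum t v
| fl_sum_cat s t v w r : (0 < size s)%N -> (0 < size t)%N ->
    fl_sum s v -> fl_sum t w -> fl (v + w) r -> fl_sum (s ++ t) r.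

Definition fl_add n (v w r : 'cV[R]_n) : Prop :=
  forall i, fl (v i 0 + w i 0) (r i 0).

Definition fl_sub n (v w r : 'cV[R]_n) : Prop :=
  forall i, fl (v i 0 - w i 0) (r i 0).

Definition fl_mulmx m n (B : 'M[R]_(m, n)) (v : 'cV[R]_n) (r : 'cV[R]_m) :=
  forall i, exists p : 'I_n -> R,
    (forall j, fl (B i j * v j 0) (p j)) /\
    fl_sum [seq p j | j <- enum 'I_n] (r i 0).

(* z i = (y i - \sum_(j | P i j) T i j * z j) / T i i; the subtractions are
   additions of negated products, negation being exact. *)
Definition fl_subst n (P : rel 'I_n) (T : 'M[R]_n) (y z : 'cV[R]_n) : Prop :=
  forall i, exists (p : 'I_n -> R) (s : R),
    [/\ forall j, P i j -> fl (T i j * z j 0) (p j),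
        fl_sum (y i 0 :: [seq - p j | j <- enum 'I_n & P i j]) s &
        fl (s / T i i) (z i 0)].

Definition fl_trisolve n (T : 'M[R]_n) (y z : 'cV[R]_n) : Prop :=
     (is_trig_mx T /\ fl_subst (fun i j => (j < i)%N) T y z)
  \/ (is_trig_mx T^T /\ fl_subst (fun i j => (i < j)%N) T y z).

(* xi and xj are consecutive computed iterates; solver maps c to the computed
   output of the inner solver on the right-hand side c. *)
Definition fl_refine m n (A : 'M[R]_(m, n)) (b : 'cV[R]_m) (Rh : 'M[R]_n)
    (solver : 'cV[R]_n -> 'cV[R]_n) (xi xj : 'cV[R]_n) : Prop :=
  exists (Ax r : 'cV[R]_m) (g c d : 'cV[R]_n),
    [/\ fl_mulmx A xi Ax, fl_sub b Ax r & fl_mulmx A^T r g] /\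
    [/\ fl_trisolve Rh^T g c, fl_trisolve Rh (solver c) d & fl_add xi d xj].

End FloatingPoint.

(* Main.v *)
Require Import Defs.
From mathcomp Require Import all_boot all_order all_algebra.
From mathcomp Require Import all_classical all_reals.
From mathcomp Require Import ring lra.

(** Why two refinement steps suffice.

Write [M = A R^-1] for the preconditioned matrix. One step of refinement from
[p] to [q] is exact up to the errors of seven operations. Multiplying
by [A^T A], the step satisfies [A^T A (x - q) = A^T f + g] ([refine_step]),
where [f] collects errors that look like a perturbation of [A] applied to the
iterates and [g] errors that look like a perturbation of [A^T] applied to the
residual. The size of the preconditioner never matters by itself: the two
triangular solves only produce the product of the norms of [R] and [M], which is
bounded by the condition number of [M] because [A = M R].

Testing this equation with [x - q] gives [|A (x - q)| <= |f| + kappa |g|]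
([gram_bound]). After the first step, starting from an error of the order of
the optimal residual, this is the strong forward bound
([first_iterate_bound]).

For the second step this forward bound is fed back into the bounds on [f] and
[g]. Assumption (B) says that the contributions of the first iterate are at most
multiples of [|x2|], so that [|f| <= a |x2|] and [|g| <= a |b - A x2|], with [a]
a polynomial multiple of [u], unless the residual is already of order [a |x2|]
([second_iterate_bounds]). Such a splitting of the residual of the normal
equations is backward stability: an explicit perturbation of rank at most two
turns the iterate into an exact least-squares solution
([backward_error_split]).

The extreme singular values are related to the norms of [A v] through a
variational argument without compactness ([max_singular_value],
[min_singular_value]). Every polynomial prefactor of the hypotheses is bounded
by one polynomial [P], so that all constants are numbers times powers of [P]. *)

Set Implicit Arguments.
Unset Strict Implicit.
Unset Printing Implicit Defensive.

Import Order.TTheory GRing.Theory Num.Theory.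
Local Open Scope ring_scope.

(** * Inner products and norms *)

Section InnerProduct.
Variable R : realType.

Definition dot n (v w : 'cV[R]_n) : R := (v^T *m w) 0 0.

Lemma dotE n (v w : 'cV[R]_n) : dot v w = \sum_i v i 0 * w i 0.
Proof. by rewrite /dot !mxE; apply: eq_bigr => i _; rewrite !mxE. Qed.

Lemma dotC n (v w : 'cV[R]_n) : dot v w = dot w v.
Proof. by rewrite !dotE; apply: eq_bigr => i _; rewrite mulrC. Qed.

Lemma dotDl n (v w z : 'cV[R]_n) : dot (v + w) z = dot v z + dot w z.
Proof. by rewrite /dot linearD mulmxDl !mxE. Qed.

Lemma dotZl n a (v z : 'cV[R]_n) : dot (a *: v) z = a * dot v z.
Proof. by rewrite /dot linearZ -scalemxAl !mxE. Qed.

Lemma dotNl n (v z : 'cV[R]_n) : dot (- v) z = - dot v z.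
Proof. by rewrite -scaleN1r dotZl mulN1r. Qed.

Lemma dotDr n (v w z : 'cV[R]_n) : dot z (v + w) = dot z v + dot z w.
Proof. by rewrite !(dotC z) dotDl. Qed.

Lemma dotZr n a (v z : 'cV[R]_n) : dot z (a *: v) = a * dot z v.
Proof. by rewrite !(dotC z) dotZl. Qed.

Lemma dotNr n (v z : 'cV[R]_n) : dot z (- v) = - dot z v.
Proof. by rewrite !(dotC z) dotNl. Qed.

Lemma dot0r n (z : 'cV[R]_n) : dot z 0 = 0.
Proof. by rewrite -(scale0r 0) dotZr mul0r. Qed.

Lemma dot_mulmx m n (B : 'M[R]_(m, n)) v w :
  dot (B *m v) w = dot v (B^T *m w).
Proof. by rewrite /dot trmx_mul mulmxA. Qed.

Lemma enorm_ge0 n (v : 'cV[R]_n) : 0 <= enorm v.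
Proof. exact: sqrtr_ge0. Qed.

Lemma enorm_sqr n (v : 'cV[R]_n) : enorm v ^+ 2 = dot v v.
Proof.
rewrite sqr_sqrtr ?dotE; first by apply: eq_bigr => i _; rewrite expr2.
by apply: sumr_ge0 => i _; apply: sqr_ge0.
Qed.

Lemma dot_ge0 n (v : 'cV[R]_n) : 0 <= dot v v.
Proof. by rewrite -enorm_sqr sqr_ge0. Qed.

Lemma enorm_eq0 n (v : 'cV[R]_n) : (enorm v == 0) = (v == 0).
Proof.
apply/idP/eqP => [|->]; last by rewrite -sqrf_eq0 enorm_sqr dot0r.
rewrite -sqrf_eq0 enorm_sqr dotE psumr_eq0 => [/allP v0|i _]; last first.
  by rewrite -expr2 sqr_ge0.
apply/colP => i; have := v0 i (mem_index_enum i).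
by rewrite mulf_eq0 orbb !mxE => /eqP.
Qed.

Lemma enorm_gt0 n (v : 'cV[R]_n) : (0 < enorm v) = (v != 0).
Proof. by rewrite lt_def enorm_ge0 andbT enorm_eq0. Qed.

Lemma enormZ n a (v : 'cV[R]_n) : enorm (a *: v) = `|a| * enorm v.
Proof.
apply/eqP; rewrite -(@eqrXn2 _ 2) ?mulr_ge0 ?enorm_ge0 //.
by rewrite exprMn !enorm_sqr real_normK ?num_real // dotZl dotZr mulrA expr2.
Qed.

Lemma enormN n (v : 'cV[R]_n) : enorm (- v) = enorm v.
Proof. by rewrite -scaleN1r enormZ normrN1 mul1r. Qed.

(** The form [v, w |-> <v, N w>] is nonnegative on [v - t w] for every [t]; the
best [t] is the quotient of the mixed by the second diagonal value. General
[N] is needed for the spectral argument of [psd_unit_coercive]; [N = 1] is the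
usual inequality. *)
Lemma cauchy_schwarz_form n (N : 'M[R]_n) (v w : 'cV[R]_n) :
  N^T = N -> (forall z, 0 <= dot z (N *m z)) ->
  dot v (N *m w) ^+ 2 <= dot v (N *m v) * dot w (N *m w).
Proof.
move=> Ns Np.
have sym : dot w (N *m v) = dot v (N *m w) by rewrite dotC dot_mulmx Ns.
have q t : 0 <= dot v (N *m v) - 2 * t * dot v (N *m w) +
    t ^+ 2 * dot w (N *m w).
  have := Np (v - t *: w); rewrite mulmxBr -scalemxAr !(dotDl, dotDr).
  rewrite !(dotNl, dotNr, dotZl, dotZr) sym => /le_trans; apply.
  by rewrite le_eqVlt; apply/orP; left; apply/eqP; ring.
move: (Np v) (Np w) q.
set a := dot v _; set b := dot v _; set c := dot w _ => a0 c0 q.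
(* If <w, N w> vanishes, the polynomial in t is affine and bounded below, hence
   constant; t below would make it negative if b were nonzero. *)
have [cp|] := boolP (0 < c); last first.
  rewrite -leNgt => cle; have c00 : c = 0 by apply/eqP; rewrite eq_le cle.
  rewrite c00 mulr0; have [->|b0] := eqVneq b 0; first by rewrite expr0n.
  have := q ((a + 1) / (2 * b)); rewrite c00 mulr0 addr0.
  have -> : 2 * ((a + 1) / (2 * b)) * b = a + 1 by field.
  by lra.
have := q (b / c).
have -> : a - 2 * (b / c) * b + (b / c) ^+ 2 * c = (a * c - b ^+ 2) / c.
  by field; rewrite gt_eqF.
by rewrite pmulr_lge0 ?invr_gt0 // subr_ge0.
Qed.

Lemma cauchy_schwarz n (v w : 'cV[R]_n) : `|dot v w| <= enorm v * enorm w.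
Proof.
rewrite -(@ler_pXn2r _ 2) ?nnegrE ?mulr_ge0 ?enorm_ge0 //.
rewrite real_normK ?num_real // exprMn !enorm_sqr.
have /= := @cauchy_schwarz_form n 1%:M v w; rewrite !mul1mx; apply.
  exact: trmx1.
by move=> z; rewrite mul1mx dot_ge0.
Qed.

Lemma enormD n (v w : 'cV[R]_n) : enorm (v + w) <= enorm v + enorm w.
Proof.
rewrite -(@ler_pXn2r _ 2) ?nnegrE ?addr_ge0 ?enorm_ge0 //.
rewrite sqrrD !enorm_sqr dotDl !dotDr (dotC w v).
have := ler_norm (dot v w); have := cauchy_schwarz v w.
by rewrite mulr2n => h1 h2; lra.
Qed.

Lemma enormB n (v w : 'cV[R]_n) : enorm (v - w) <= enorm v + enorm w.
Proof. by rewrite -(enormN w); apply: enormD. Qed.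

Lemma ler_enorm_sqr n p (v : 'cV[R]_n) (w : 'cV[R]_p) :
  (enorm v <= enorm w) = (dot v v <= dot w w).
Proof. by rewrite -!enorm_sqr ler_pXn2r ?nnegrE ?enorm_ge0. Qed.

Lemma ler_enorm_bound n p k (v : 'cV[R]_n) (w : 'cV[R]_p) : 0 <= k ->
  (enorm v <= k * enorm w) = (dot v v <= k ^+ 2 * dot w w).
Proof.
move=> k0; rewrite -!enorm_sqr -exprMn ler_pXn2r ?nnegrE ?enorm_ge0 //.
by rewrite mulr_ge0 ?enorm_ge0.
Qed.

(** Duality: [|B^T w|^2 = <w, B B^T w>] is at most [k |w| |B^T w|]. *)
Lemma enorm_mulmx_tr m n (B : 'M[R]_(m, n)) k : 0 <= k ->
  (forall v, enorm (B *m v) <= k * enorm v) ->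
  forall w, enorm (B^T *m w) <= k * enorm w.
Proof.
move=> k0 Bk w; have [z|nz] := eqVneq (enorm (B^T *m w)) 0.
  by rewrite z mulr_ge0 ?enorm_ge0.
have zp : 0 < enorm (B^T *m w) by rewrite lt_def nz enorm_ge0.
rewrite -(ler_pM2r zp) -expr2 enorm_sqr dot_mulmx trmxK.
apply: (le_trans (ler_norm _)); apply: (le_trans (cauchy_schwarz _ _)).
by have := Bk (B^T *m w); have := enorm_ge0 w; nra.
Qed.

Lemma frobenius_ge0 m n (B : 'M[R]_(m, n)) : 0 <= frobenius B.
Proof. exact: sqrtr_ge0. Qed.

Lemma frobenius_sqr m n (B : 'M[R]_(m, n)) :
  frobenius B ^+ 2 = \sum_i \sum_j B i j ^+ 2.
Proof.
by rewrite sqr_sqrtr // !sumr_ge0 // => i _; rewrite sumr_ge0 // => j _;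
  rewrite sqr_ge0.
Qed.

(** This identification transfers the triangle inequality to the Frobenius
norm. *)
Lemma frobenius_mxvec m n (B : 'M[R]_(m, n)) :
  frobenius B = enorm (mxvec B)^T.
Proof.
rewrite /frobenius /enorm; congr Num.sqrt.
rewrite pair_big (reindex _ (curry_mxvec_bij _ _)) /=.
by apply: eq_bigr => -[i j] _ /=; rewrite mxE mxvecE.
Qed.

Lemma frobeniusB m n (B D : 'M[R]_(m, n)) :
  frobenius (B - D) <= frobenius B + frobenius D.
Proof. by rewrite !frobenius_mxvec !linearB; apply: enormB. Qed.

Lemma frobenius_tr m n (B : 'M[R]_(m, n)) : frobenius B^T = frobenius B.
Proof.
rewrite /frobenius exchange_big; congr Num.sqrt.
by apply: eq_bigr => i _; apply: eq_bigr => j _; rewrite mxE.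
Qed.

Lemma frobenius_outer m n (v : 'cV[R]_m) (w : 'cV[R]_n) :
  frobenius (v *m w^T) = enorm v * enorm w.
Proof.
apply/eqP; rewrite -(@eqrXn2 _ 2) ?mulr_ge0 ?enorm_ge0 ?frobenius_ge0 //.
rewrite frobenius_sqr exprMn !enorm_sqr !dotE big_distrl /=; apply/eqP.
apply: eq_bigr => i _; rewrite big_distrr; apply: eq_bigr => j _ /=.
by rewrite !mxE big_ord1 !mxE exprMn !expr2.
Qed.

(** Rounding errors of products and triangular solves are bounded entrywise by
[|B| |v|]; Cauchy-Schwarz on each row turns this into a normwise bound. *)
Lemma frobenius_bound m n (B : 'M[R]_(m, n)) (w : 'cV[R]_m) (v : 'cV[R]_n) k :
  0 <= k ->
  (forall i, `|w i 0| <= k * \sum_j `|B i j| * `|v j 0|) ->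
  enorm w <= k * (frobenius B * enorm v).
Proof.
move=> k0 wk.
rewrite -(@ler_pXn2r _ 2) ?nnegrE ?mulr_ge0 ?enorm_ge0 ?frobenius_ge0 //.
rewrite enorm_sqr dotE !exprMn frobenius_sqr mulr_suml mulr_sumr.
apply: ler_sum => i _; rewrite -expr2 -real_normK ?num_real //.
apply: (@le_trans _ _ ((k * \sum_j `|B i j| * `|v j 0|) ^+ 2)).
  by rewrite ler_pXn2r ?nnegrE ?(le_trans _ (wk i)) //.
rewrite exprMn ler_wpM2l ?sqr_ge0 //.
pose p := \col_j `|B i j|; pose q := \col_j `|v j 0|.
have -> : \sum_j B i j ^+ 2 = enorm p ^+ 2.
  rewrite enorm_sqr dotE; apply: eq_bigr => j _.
  by rewrite mxE -expr2 real_normK ?num_real.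
have -> : enorm v ^+ 2 = enorm q ^+ 2.
  rewrite !enorm_sqr !dotE; apply: eq_bigr => j _.
  by rewrite mxE -!expr2 real_normK ?num_real.
have -> : \sum_j `|B i j| * `|v j 0| = dot p q.
  by rewrite dotE; apply: eq_bigr => j _; rewrite !mxE.
rewrite -exprMn -[X in X <= _]real_normK ?num_real //.
by rewrite ler_pXn2r ?nnegrE ?mulr_ge0 ?enorm_ge0 ?cauchy_schwarz.
Qed.

Lemma enorm_mulmx_frobenius m n (B : 'M[R]_(m, n)) v :
  enorm (B *m v) <= frobenius B * enorm v.
Proof.
rewrite -[leRHS]mul1r; apply: frobenius_bound => // i.
rewrite mul1r mxE; apply: (le_trans (ler_norm_sum _ _ _)).
by apply: ler_sum => j _; rewrite normrM.
Qed.

(** Each column of [B] is the image of a unit vector. The sharp factor would be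
[sqrt n]; a polynomial factor is enough here. *)
Lemma frobenius_le_op m n (B : 'M[R]_(m, n)) k : 0 <= k ->
  (forall v, enorm (B *m v) <= k * enorm v) -> frobenius B <= n%:R * k.
Proof.
move=> k0 Bk.
rewrite -(@ler_pXn2r _ 2) ?nnegrE ?mulr_ge0 ?frobenius_ge0 //.
rewrite frobenius_sqr exchange_big /=.
apply: (@le_trans _ _ (\sum_(j < n) k ^+ 2)); last first.
  rewrite sumr_const card_ord -[leLHS]mulr_natl exprMn ler_wpM2r ?sqr_ge0 //.
  by rewrite -natrX ler_nat; case: (n) => // p; rewrite leq_pmulr.
apply: ler_sum => j _; have := Bk (delta_mx j 0); rewrite -colE.
rewrite ler_enorm_bound // !dotE => /le_trans h.
have -> : \sum_i B i j ^+ 2 = \sum_i col j B i 0 * col j B i 0.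
  by apply: eq_bigr => i _; rewrite !mxE expr2.
apply: h; rewrite (bigD1 j) //= big1 => [|i ij].
  by rewrite !mxE !eqxx addr0 !mulr1.
by rewrite !mxE (negPf ij) mul0r.
Qed.

End InnerProduct.

(** * Extreme singular values *)

Section SingularValues.
Local Open Scope classical_set_scope.
Variable R : realType.

(** Cauchy-Schwarz for the form of [N], applied to [v] and [N^-1 v], gives
[|v|^4 <= <v, N v> <v, N^-1 v>], and the last factor is at most a multiple of
[|v|^2]. Hence a semidefinite matrix whose form comes arbitrarily close to [0]
on unit vectors is singular. This replaces compactness of the sphere in the
proof that extreme Rayleigh quotients are eigenvalues. *)
Lemma psd_unit_coercive n (N : 'M[R]_n) : N^T = N ->
  (forall v, 0 <= dot v (N *m v)) -> N \in unitmx ->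
  exists2 e, 0 < e & forall v, e * dot v v <= dot v (N *m v).
Proof.
move=> Ns Np Nu; pose k := frobenius (invmx N) + 1.
have k0 : 0 < k by rewrite ltr_wpDl // frobenius_ge0.
exists k^-1; first by rewrite invr_gt0.
move=> v; rewrite ler_pdivrMl //.
have [->|v0] := eqVneq v 0; first by rewrite mulmx0 !dot0r mulr0.
have vp : 0 < dot v v by rewrite -enorm_sqr exprn_gt0 // enorm_gt0.
have := cauchy_schwarz_form v (invmx N *m v) Ns Np.
rewrite mulKVmx // => cs.
have h : dot (invmx N *m v) v <= k * dot v v.
  apply: (le_trans (ler_norm _)); apply: (le_trans (cauchy_schwarz _ _)).
  rewrite -enorm_sqr expr2 mulrA ler_wpM2r ?enorm_ge0 //.
  apply: (le_trans (enorm_mulmx_frobenius _ _)).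
  by rewrite ler_wpM2r ?enorm_ge0 // ler_wpDr.
have := le_trans cs (ler_wpM2l (Np v) h).
by rewrite mulrA expr2 ler_pM2r // mulrC.
Qed.

Lemma non_eigenvalue_unitmx n (S : 'M[R]_n) a :
  ~~ eigenvalue S a -> S - a%:M \in unitmx.
Proof. by rewrite /eigenvalue /eigenspace negbK kermx_eq0 row_free_unit. Qed.

Lemma dot_gram m n (B : 'M[R]_(m, n)) (v : 'cV[R]_n) :
  dot v (B^T *m B *m v) = enorm (B *m v) ^+ 2.
Proof. by rewrite enorm_sqr dot_mulmx mulmxA. Qed.

Lemma gram_tr m n (B : 'M[R]_(m, n)) : (B^T *m B)^T = B^T *m B.
Proof. by rewrite trmx_mul trmxK. Qed.

Lemma singular_value_attained m n (B : 'M[R]_(m, n)) s : singular_value B s ->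
  exists2 v, v != 0 & enorm (B *m v) = s * enorm v.
Proof.
move=> [s0 /eigenvalueP[w we w0]]; exists w^T.
  by rewrite trmx_eq0.
apply/eqP; rewrite -(@eqrXn2 _ 2) ?mulr_ge0 ?enorm_ge0 //.
rewrite -dot_gram -[B^T *m B]gram_tr -trmx_mul we linearZ dotZr.
by rewrite exprMn enorm_sqr.
Qed.

(** The quotients are squared: their extrema are then eigenvalues of the Gram
matrix. *)
Definition rayleigh m n (B : 'M[R]_(m, n)) : set R :=
  [set (enorm (B *m v) / enorm v) ^+ 2 | v in [set v | v != 0]].

Lemma rayleigh_mem m n (B : 'M[R]_(m, n)) v : v != 0 ->
  rayleigh B ((enorm (B *m v) / enorm v) ^+ 2).
Proof. by move=> v0; exists v. Qed.

Lemma rayleigh_nonempty m n (B : 'M[R]_(m, n)) : (0 < n)%N ->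
  rayleigh B !=set0.
Proof.
move=> n0; pose v : 'cV[R]_n := const_mx 1.
exists ((enorm (B *m v) / enorm v) ^+ 2).
apply: rayleigh_mem; apply/eqP => /colP/(_ (Ordinal n0)).
by rewrite !mxE => /eqP; rewrite oner_eq0.
Qed.

(** Let [l] be the supremum of the squared Rayleigh quotients. The form of
[l - B^T B] is semidefinite and not coercive, so [l - B^T B] is singular and
[l] is an eigenvalue of [B^T B]. *)
Lemma max_singular_value m n (B : 'M[R]_(m, n)) : (0 < n)%N ->
  exists2 s, singular_value B s & forall v, enorm (B *m v) <= s * enorm v.
Proof.
move=> n0; have ne := rayleigh_nonempty B n0.
have ubF : ubound (rayleigh B) (frobenius B ^+ 2).
  move=> _ [v /= v0 <-]; rewrite ler_pXn2r ?nnegrE ?frobenius_ge0 //; last first.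
    by rewrite divr_ge0 ?enorm_ge0.
  by rewrite ler_pdivrMr ?enorm_gt0 // enorm_mulmx_frobenius.
have hs : has_sup (rayleigh B) by split=> //; exists (frobenius B ^+ 2).
pose l := sup (rayleigh B).
have lub v : enorm (B *m v) ^+ 2 <= l * enorm v ^+ 2.
  have [->|v0] := eqVneq v 0.
    by rewrite mulmx0 !enorm_sqr !dot0r mulr0.
  rewrite -ler_pdivrMr ?exprn_gt0 ?enorm_gt0 // -expr_div_n.
  exact: (ub_le_sup (proj2 hs) (rayleigh_mem B v0)).
have l0 : 0 <= l.
  have [_ [v /= v0 _]] := ne.
  apply: (le_trans (sqr_ge0 (enorm (B *m v) / enorm v))).
  exact: (ub_le_sup (proj2 hs) (rayleigh_mem B v0)).
exists (Num.sqrt l); last first.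
  move=> v; rewrite -(@ler_pXn2r _ 2) // ?nnegrE ?mulr_ge0 ?sqrtr_ge0
    ?enorm_ge0 //.
  by rewrite exprMn [Num.sqrt l ^+ 2]sqr_sqrtr // ?lub ?llb.
split; first exact: sqrtr_ge0.
rewrite sqr_sqrtr //; apply: contraT => /non_eigenvalue_unitmx U.
have NE v : dot v ((l%:M - B^T *m B) *m v) = l * dot v v - enorm (B *m v) ^+ 2.
  by rewrite mulmxBl mul_scalar_mx dotDr dotNr dotZr dot_gram.
have [||| e e0 eP] := @psd_unit_coercive n (l%:M - B^T *m B).
- by rewrite linearB /= tr_scalar_mx gram_tr.
- by move=> v; rewrite NE subr_ge0 -enorm_sqr.
- by rewrite -opprB -scaleN1r unitmxZ // unitrN1.
have : l <= l - e.
  apply: ge_sup => // _ [v /= v0 <-].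
  rewrite expr_div_n ler_pdivrMr ?exprn_gt0 ?enorm_gt0 //.
  by have := eP v; rewrite NE -enorm_sqr; lra.
by lra.
Qed.

(** As for the maximum, with [B^T B - l] and the infimum [l]. *)
Lemma min_singular_value m n (B : 'M[R]_(m, n)) : (0 < n)%N ->
  exists2 s, singular_value B s & forall v, s * enorm v <= enorm (B *m v).
Proof.
move=> n0; have ne := rayleigh_nonempty B n0.
have lb0 : lbound (rayleigh B) 0 by move=> _ [v /= v0 <-]; apply: sqr_ge0.
have hi : has_inf (rayleigh B) by split=> //; exists 0.
pose l := inf (rayleigh B).
have llb v : l * enorm v ^+ 2 <= enorm (B *m v) ^+ 2.
  have [->|v0] := eqVneq v 0.
    by rewrite mulmx0 !enorm_sqr !dot0r mulr0.
  rewrite -ler_pdivlMr ?exprn_gt0 ?enorm_gt0 // -expr_div_n.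
  exact: (ge_inf (proj2 hi) (rayleigh_mem B v0)).
have l0 : 0 <= l by apply: lb_le_inf.
exists (Num.sqrt l); last first.
  move=> v; rewrite -(@ler_pXn2r _ 2) // ?nnegrE ?mulr_ge0 ?sqrtr_ge0
    ?enorm_ge0 //.
  by rewrite exprMn [Num.sqrt l ^+ 2]sqr_sqrtr // ?lub ?llb.
split; first exact: sqrtr_ge0.
rewrite sqr_sqrtr //; apply: contraT => /non_eigenvalue_unitmx U.
have NE v : dot v ((B^T *m B - l%:M) *m v) = enorm (B *m v) ^+ 2 - l * dot v v.
  by rewrite mulmxBl mul_scalar_mx dotDr dotNr dotZr dot_gram.
have [|| e e0 eP] := @psd_unit_coercive n (B^T *m B - l%:M) _ _ U.
- by rewrite linearB /= tr_scalar_mx gram_tr.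
- by move=> v; rewrite NE subr_ge0 -enorm_sqr.
have : l + e <= l.
  apply: lb_le_inf => // _ [v /= v0 <-].
  rewrite expr_div_n ler_pdivlMr ?exprn_gt0 ?enorm_gt0 //.
  by have := eP v; rewrite NE -enorm_sqr; lra.
by lra.
Qed.

Lemma sigma_max_le m n (B : 'M[R]_(m, n)) k : (0 < n)%N ->
  (forall v, enorm (B *m v) <= k * enorm v) -> sigma_max B <= k.
Proof.
move=> n0 Bk; have [s sB _] := max_singular_value B n0.
apply: ge_sup => [|t /= /singular_value_attained[v v0 vt]]; first by exists s.
by have := Bk v; rewrite vt ler_pM2r // enorm_gt0.
Qed.

Lemma sigma_min_ge m n (B : 'M[R]_(m, n)) k : (0 < n)%N ->
  (forall v, k * enorm v <= enorm (B *m v)) -> k <= sigma_min B.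
Proof.
move=> n0 Bk; have [s sB _] := min_singular_value B n0.
apply: lb_le_inf => [|t /= /singular_value_attained[v v0 vt]]; first by exists s.
by have := Bk v; rewrite vt ler_pM2r // enorm_gt0.
Qed.

Lemma enorm_mulmx_sigma_max m n (B : 'M[R]_(m, n)) v : (0 < n)%N ->
  enorm (B *m v) <= sigma_max B * enorm v.
Proof.
move=> n0; have [s sB sv] := max_singular_value B n0.
apply: (le_trans (sv v)); rewrite ler_wpM2r ?enorm_ge0 //.
apply: ub_le_sup => //; exists (frobenius B).
move=> t /= /singular_value_attained[w w0 wt].
have := enorm_mulmx_frobenius B w.
by rewrite wt ler_pM2r // enorm_gt0.
Qed.

Lemma sigma_min_mulmx_enorm m n (B : 'M[R]_(m, n)) v : (0 < n)%N ->
  sigma_min B * enorm v <= enorm (B *m v).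
Proof.
move=> n0; have [s sB sv] := min_singular_value B n0.
apply: le_trans (sv v); rewrite ler_wpM2r ?enorm_ge0 //.
by apply: ge_inf => //; exists 0 => t [].
Qed.

End SingularValues.

Section SpectralConsequences.
Local Open Scope classical_set_scope.
Variable R : realType.

Lemma spectral_norm1_dim m n (A : 'M[R]_(m, n)) :
  spectral_norm A = 1 -> (0 < n)%N.
Proof.
case: n A => // A; rewrite /spectral_norm /sigma_max.
have -> : [set s | singular_value A s] = set0.
  rewrite -subset0 => s /= /singular_value_attained[v v0 _].
  by rewrite [v]flatmx0 eqxx in v0.
by rewrite sup0 => /eqP; rewrite eq_sym oner_eq0.
Qed.

Lemma sigma_min_le_max m n (A : 'M[R]_(m, n)) :
  (0 < n)%N -> sigma_min A <= sigma_max A.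
Proof.
move=> n0; have [s /singular_value_attained[v v0 _] _] := max_singular_value A n0.
have vp : 0 < enorm v by rewrite enorm_gt0.
rewrite -(ler_pM2r vp).
exact: le_trans (sigma_min_mulmx_enorm A v n0) (enorm_mulmx_sigma_max A v n0).
Qed.

(** This makes the condition number of the preconditioned matrix a genuine
quotient, not a division by zero. It holds because [|T^-1 v|] is at least
[|v|] divided by the Frobenius norm of [T]. *)
Lemma sigma_min_invmx_gt0 m n (A : 'M[R]_(m, n)) (T : 'M[R]_n) : (0 < n)%N ->
  0 < sigma_min A -> T \in unitmx -> 0 < sigma_min (A *m invmx T).
Proof.
move=> n0 sA Tu; pose k := frobenius T + 1.
have k0 : 0 < k by rewrite ltr_wpDl ?frobenius_ge0.
apply: (@lt_le_trans _ _ (sigma_min A / k)); first by rewrite divr_gt0.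
apply: sigma_min_ge => // v; rewrite mulrAC ler_pdivrMr //.
have := sigma_min_mulmx_enorm A (invmx T *m v) n0; rewrite mulmxA => h.
have : enorm v <= k * enorm (invmx T *m v).
  rewrite -{1}[v](mulKVmx Tu); apply: (le_trans (enorm_mulmx_frobenius _ _)).
  by rewrite ler_wpM2r ?enorm_ge0 // lerDl.
move/(ler_wpM2l (ltW sA)) => /le_trans; apply.
by rewrite mulrCA mulrC ler_pM2r.
Qed.

(** [A = M T] and [|A v| <= |v|] bound [T] by the inverse of the smallest
singular value of [M]. The product with the largest one is the only
way in which the size of the preconditioner is controlled. *)
Lemma frobenius_precond m n (A : 'M[R]_(m, n)) (T : 'M[R]_n) : (0 < n)%N ->
  sigma_max A = 1 -> 0 < sigma_min (A *m invmx T) -> T \in unitmx ->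
  frobenius T * sigma_max (A *m invmx T) <= n%:R * cond (A *m invmx T).
Proof.
move=> n0 sA sM Tu; set M := A *m invmx T in sM *.
have smax : 0 <= sigma_max M.
  by apply: le_trans (sigma_min_le_max M n0); apply: ltW.
have FT : frobenius T <= n%:R * (sigma_min M)^-1.
  apply: frobenius_le_op => [|v]; first by rewrite invr_ge0 ltW.
  rewrite ler_pdivlMl //; apply: (le_trans (sigma_min_mulmx_enorm M _ n0)).
  rewrite mulmxA mulmxKV //; apply: (le_trans (enorm_mulmx_sigma_max A v n0)).
  by rewrite sA mul1r.
by rewrite /cond [sigma_max M / _]mulrC mulrA ler_wpM2r.
Qed.

End SpectralConsequences.

(** * Least squares and backward errors *)

Section LeastSquaresTheory.
Local Open Scope classical_set_scope.
Variables (R : realType) (m n : nat).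
Implicit Types (A D : 'M[R]_(m, n)) (b : 'cV[R]_m) (x z : 'cV[R]_n).

Lemma normal_equations_lsq A b x :
  A^T *m (b - A *m x) = 0 -> lsq_solution A b x.
Proof.
move=> ne z; rewrite ler_enorm_sqr.
set r := b - A *m x in ne *.
have -> : b - A *m z = r + A *m (x - z) by rewrite mulmxBr addrA subrK.
clearbody r; rewrite dotDl !dotDr (dotC r (A *m _)) [dot (A *m _) r]dot_mulmx.
rewrite ne dot0r addr0 add0r.
by rewrite lerDl dot_ge0.
Qed.

(** With [w = A^T r], moving the minimizer by [w] changes [|r|^2] by
[|A w|^2 - 2 |w|^2], which is negative unless [w = 0] because [A] is a
contraction. *)
Lemma lsq_normal_equations A b x :
  (forall v, enorm (A *m v) <= enorm v) ->
  lsq_solution A b x -> A^T *m (b - A *m x) = 0.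
Proof.
move=> A1 ls; set r := b - A *m x; set w := A^T *m r.
have wE : w = A^T *m r by [].
have := ls (x + w); rewrite ler_enorm_sqr mulmxDr opprD addrA -/r.
clearbody w; clearbody r.
have := A1 w; rewrite ler_enorm_sqr.
rewrite !(dotDl, dotDr) !(dotNl, dotNr) (dotC r (A *m w)).
have -> : dot (A *m w) r = dot w w by rewrite dot_mulmx -wE.
move=> h1 h2; apply/eqP; rewrite -enorm_eq0 -sqrf_eq0 eq_le sqr_ge0 andbT.
by rewrite enorm_sqr; lra.
Qed.

(** Testing the equation with [z] gives [|A z|^2 = <A z, f> + <z, g>], and [|z|]
is at most [kap |A z|]. *)
Lemma gram_bound A kap z f g : 0 <= kap ->
  (forall v, enorm v <= kap * enorm (A *m v)) ->
  A^T *m (A *m z) = A^T *m f + g ->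
  enorm (A *m z) <= enorm f + kap * enorm g.
Proof.
move=> k0 Ak E; have [->|nz] := eqVneq (enorm (A *m z)) 0.
  by rewrite addr_ge0 ?mulr_ge0 ?enorm_ge0.
have zp : 0 < enorm (A *m z) by rewrite lt_def nz enorm_ge0.
rewrite -(ler_pM2l zp) -expr2 enorm_sqr dot_mulmx E dotDr -dot_mulmx.
rewrite mulrDr; apply: lerD; apply: (le_trans (ler_norm _)).
  exact: cauchy_schwarz.
apply: (le_trans (cauchy_schwarz _ _)).
by rewrite mulrCA mulrA ler_wpM2r ?enorm_ge0.
Qed.

Lemma backward_error_le A D b x : lsq_solution (A + D) b x ->
  backward_error A b x <= frobenius D.
Proof.
move=> ls; apply: ge_inf; last by exists D.
by exists 0 => _ [E _ <-]; apply: frobenius_ge0.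
Qed.

(** The perturbation [r x^T / |x|^2] makes the system consistent. *)
Lemma backward_error_residual A b x : x != 0 ->
  backward_error A b x <= enorm (b - A *m x) / enorm x.
Proof.
move=> x0; set r := b - _.
have xp : 0 < enorm x by rewrite enorm_gt0.
pose D := (enorm x ^- 2) *: (r *m x^T).
have DE : (A + D) *m x = b.
  rewrite mulmxDl -scalemxAl -mulmxA [x^T *m x]mx11_scalar -/(dot x x).
  rewrite -enorm_sqr mul_mx_scalar scalerA mulVf ?scale1r ?expf_neq0 ?gt_eqF //.
  by rewrite addrC subrK.
have lsD : lsq_solution (A + D) b x.
  by apply: normal_equations_lsq; rewrite DE subrr mulmx0.
apply: (le_trans (backward_error_le lsD)).
rewrite /D scalemxAl frobenius_outer enormZ ger0_norm ?invr_ge0 ?sqr_ge0 //.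
by rewrite le_eqVlt; apply/orP; left; apply/eqP; field; rewrite gt_eqF.
Qed.

(** A perturbation [D] for which [s] is the new residual must satisfy [D x = f],
with [f = b - s - A x], and [D^T s = - A^T s]. Together these force
[<s, f> = - <A^T s, x>], that is [<s, b - s> = 0]; under this condition the
rank-two matrix below meets both requirements. *)
Lemma backward_error_rank2 A b x (s : 'cV[R]_m) : x != 0 -> s != 0 ->
  dot s (b - s) = 0 ->
  backward_error A b x <=
    2 * (enorm (b - s - A *m x) / enorm x) + enorm (A^T *m s) / enorm s.
Proof.
move=> x0 s0 orth.
have xp : 0 < enorm x by rewrite enorm_gt0.
have sp : 0 < enorm s by rewrite enorm_gt0.
set f := b - s - A *m x; set g := A^T *m s.
pose D1 := (enorm x ^- 2) *: (f *m x^T).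
have D1x : D1 *m x = f.
  rewrite -scalemxAl -mulmxA [x^T *m x]mx11_scalar -/(dot x x) -enorm_sqr.
  by rewrite mul_mx_scalar scalerA mulVf ?scale1r ?expf_neq0 ?gt_eqF.
have F1 : frobenius D1 = enorm f / enorm x.
  rewrite /D1 scalemxAl frobenius_outer enormZ ger0_norm ?invr_ge0 ?sqr_ge0 //.
  by field; rewrite gt_eqF.
clearbody D1.
pose h := g + D1^T *m s.
pose D := D1 - (enorm s ^- 2) *: (s *m h^T).
have hx : dot h x = 0.
  rewrite dotDl !dot_mulmx !trmxK D1x -dotDr.
  by rewrite /f addrC subrK.
have Dx : D *m x = f.
  rewrite mulmxBl D1x -scalemxAl -mulmxA [h^T *m x]mx11_scalar -/(dot h x) hx.
  by rewrite raddf0 mulmx0 scaler0 subr0.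
have Ds : D^T *m s = - g.
  rewrite linearB /= linearZ /= trmx_mul trmxK mulmxBl -scalemxAl -mulmxA.
  rewrite [s^T *m s]mx11_scalar -/(dot s s) -enorm_sqr mul_mx_scalar scalerA.
  rewrite mulVf ?scale1r ?expf_neq0 ?gt_eqF // /h opprD addrCA subrr.
  by rewrite addr0.
have lsD : lsq_solution (A + D) b x.
  apply: normal_equations_lsq; rewrite mulmxDl Dx.
  have -> : b - (A *m x + f) = s by rewrite /f [A *m x + _]addrC subrK subKr.
  by rewrite linearD /= mulmxDl Ds subrr.
apply: (le_trans (backward_error_le lsD)).
apply: (le_trans (frobeniusB _ _)).
rewrite F1 scalemxAl frobenius_outer enormZ ger0_norm ?invr_ge0 ?sqr_ge0 //.
have -> : enorm s ^- 2 * enorm s * enorm h = enorm h / enorm s.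
  by field; rewrite gt_eqF.
have := enormD g (D1^T *m s); rewrite -/h.
have := enorm_mulmx_frobenius D1^T s; rewrite frobenius_tr F1 => hd hh.
rewrite [2 * _]mulr_natl mulr2n -addrA lerD2l ler_pdivrMr //.
by rewrite mulrDl divfK ?gt_eqF //; lra.
Qed.

(** The computed solution satisfies the normal equations up to an error [A^T f]
of the size of a perturbation of [A] acting on [x], and an error [g] of the size
of a perturbation of [A^T] acting on the residual [r]. If [|r| < 8 a |x|],
the residual is removed altogether. Otherwise [r - f] is almost an admissible
residual in the sense of [backward_error_rank2]: its rescaling [t (r - f)] with
[<s, b - s> = 0] differs from it by [O (a |x|)]. In
the application the bound on [g] holds only for a residual that is not small,
hence the implication. *)
Lemma backward_error_split A b x f g a : 0 < a -> x != 0 ->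
  A^T *m (b - A *m x) = A^T *m f + g ->
  enorm f <= a * enorm x ->
  (8 * a * enorm x <= enorm (b - A *m x) ->
   enorm g <= a * enorm (b - A *m x)) ->
  backward_error A b x <= 12 * a.
Proof.
move=> a0 x0 ne fa ga.
have xp : 0 < enorm x by rewrite enorm_gt0.
set r := b - A *m x in ne ga.
have [rsmall|rbig] := ltP (enorm r) (8 * a * enorm x).
  apply: (le_trans (backward_error_residual A b x0)).
  by rewrite ler_pdivrMr // -/r; nra.
have {}ga := ga rbig.
pose s0 := r - f.
have s0r : enorm r / 2 <= enorm s0.
  have := enormD s0 f; rewrite subrK; nra.
have s0p : 0 < enorm s0 by apply: lt_le_trans s0r; nra.
have g_s0 : A^T *m s0 = g by rewrite mulmxBr ne addrC addKr.
have s0b : dot s0 (b - s0) = dot s0 f + dot g x.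
  have -> : b - s0 = f + A *m x.
    by rewrite /s0 /r opprB opprD opprK addrCA [b + _]addrA subrr add0r.
  by rewrite dotDr -g_s0 dot_mulmx trmxK.
pose t := dot s0 b / enorm s0 ^+ 2.
have tE : (1 - t) * enorm s0 = - (dot s0 f + dot g x) / enorm s0.
  rewrite -s0b dotDr dotNr -enorm_sqr /t; field; rewrite gt_eqF //.
have tb : `|1 - t| * enorm s0 < 4 * a * enorm x.
  rewrite -[X in _ * X]ger0_norm ?enorm_ge0 // -normrM tE normrM normrN.
  rewrite normfV (ger0_norm (enorm_ge0 _)) ltr_pdivrMr //.
  apply: (le_lt_trans (ler_normD _ _)).
  have := cauchy_schwarz s0 f; have := cauchy_schwarz g x.
  have : enorm g * enorm x <= a * (2 * enorm s0) * enorm x.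
    by rewrite ler_wpM2r ?enorm_ge0 //; apply: (le_trans ga); nra.
  have : enorm s0 * enorm f <= enorm s0 * (a * enorm x).
    by rewrite ler_wpM2l ?enorm_ge0.
  have : 0 < a * enorm s0 * enorm x by rewrite !mulr_gt0.
  by lra.
(* If t were 0, tb would bound the residual by a multiple of a |x|, which the
   case distinction excludes. *)
have tn0 : t != 0.
  apply/eqP => t0; move: tb; rewrite t0 subr0 normr1 mul1r; nra.
have tse : dot (t *: s0) (b - t *: s0) = 0.
  rewrite dotZl dotDr dotNr dotZr -enorm_sqr /t divfK ?subrr ?mulr0 //.
  by rewrite expf_neq0 // gt_eqF.
have ts0 : t *: s0 != 0 by rewrite scaler_eq0 negb_or tn0 -enorm_gt0.
apply: (le_trans (backward_error_rank2 A x0 ts0 tse)).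
have -> : enorm (A^T *m (t *: s0)) / enorm (t *: s0) = enorm g / enorm s0.
  rewrite -scalemxAr g_s0 !enormZ; field.
  by rewrite gt_eqF // normr_eq0 tn0.
have h1 : enorm g / enorm s0 <= 2 * a by rewrite ler_pdivrMr //; nra.
have h2 : enorm (b - t *: s0 - A *m x) / enorm x <= 5 * a.
  rewrite ler_pdivrMr //.
  have -> : b - t *: s0 - A *m x = f + (1 - t) *: s0.
    rewrite scalerBl scale1r addrA /s0 [f + _]addrC subrK /r.
    by rewrite -!addrA; congr (_ + _); rewrite addrC.
  by apply: (le_trans (enormD _ _)); rewrite enormZ; lra.
by lra.
Qed.

End LeastSquaresTheory.

(** * Rounding errors of the elementary operations *)

Section RoundingErrors.
Variables (R : realType) (u : R).
Hypothesis u_ge0 : 0 <= u.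

Lemma fl_error a v : fl u a v -> `|v - a| <= u * `|a|.
Proof.
move=> [d du ->]; have -> : a * (1 + d) - a = d * a by ring.
by rewrite normrM ler_wpM2r.
Qed.

Lemma fl_error_computed a v : u <= 1 / 2 -> fl u a v ->
  `|v - a| <= 2 * u * `|v|.
Proof.
move=> u2 /fl_error va; apply: (le_trans va).
have : `|a| <= 2 * `|v|.
  have := ler_normD (a - v) v; rewrite subrK distrC.
  by have := ler_wpM2r (normr_ge0 a) u2; lra.
by move/(ler_wpM2l u_ge0); lra.
Qed.

(** Every term takes part in at most [size s - 1] additions, whatever the order.
The exponent [size s] is weaker by one, which avoids a special case for the
empty sum. *)
Lemma fl_sum_error s v : fl_sum u s v ->
  `|v - \sum_(a <- s) a| <= ((1 + u) ^+ (size s) - 1) * \sum_(a <- s) `|a|.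
Proof.
have u1 : 1 <= 1 + u by rewrite lerDl.
elim=> {s v} [|a|s t v st _ IH|s t v w r s0 t0 _ IHs _ IHt /fl_error vw].
- by rewrite !big_nil subrr normr0 mulr0.
- by rewrite !big_seq1 subrr normr0 /= expr1 mulr_ge0 // addrAC subrr add0r.
- by rewrite -(perm_size st) -!(perm_big _ st).
(* A sum of nonempty parts has at most one addition more than either part. *)
have mono (p : nat) (q : seq R) : (p < size s + size t)%N ->
    ((1 + u) ^+ p - 1) * \sum_(a <- q) `|a| <=
    ((1 + u) ^+ (size s + size t).-1 - 1) * \sum_(a <- q) `|a|.
  move=> pst; rewrite ler_wpM2r ?sumr_ge0 // lerD2r ler_weXn2l //.
  by case: (size s + size t)%N pst.
have := mono (size s) s; rewrite -{1}[size s]addn0 ltn_add2l => /(_ t0) ms.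
have := mono (size t) t; rewrite -{1}[size t]add0n ltn_add2r => /(_ s0) mt.
rewrite size_cat !big_cat /=; move: ms mt IHs IHt vw.
have -> : (size s + size t)%N = (size s + size t).-1.+1.
  by case: (size s) s0.
rewrite /= exprS; set E := (1 + u) ^+ (size s + size t).-1.
have E1 : 1 <= E by rewrite exprn_ege1.
set Ss := \sum_(a <- s) a; set Ns := \sum_(a <- s) `|a|.
set St := \sum_(a <- t) a; set Nt := \sum_(a <- t) `|a|.
have SN : `|Ss + St| <= Ns + Nt.
  by apply: (le_trans (ler_normD _ _)); rewrite lerD ?ler_norm_sum.
have N0 : 0 <= Ns + Nt by rewrite addr_ge0 ?sumr_ge0.
move=> ms mt /le_trans/(_ ms) {}ms /le_trans/(_ mt) {}mt vw.
have e1 : `|v + w - (Ss + St)| <= (E - 1) * (Ns + Nt).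
  have -> : v + w - (Ss + St) = (v - Ss) + (w - St) by ring.
  apply: (le_trans (ler_normD _ _)). lra.
have e2 : `|v + w| <= E * (Ns + Nt).
  rewrite -[v + w](subrK (Ss + St)).
  by apply: (le_trans (ler_normD _ _)); lra.
have e3 : u * `|v + w| <= u * (E * (Ns + Nt)) by rewrite ler_wpM2l.
rewrite -[r](subrK (v + w)) -addrA; apply: (le_trans (ler_normD _ _)).
by lra.
Qed.

Lemma expr1D_le k : k%:R * u <= 1 / 2 -> (1 + u) ^+ k <= 1 + 2 * (k%:R * u).
Proof.
elim: k => [|k IH]; first by rewrite mul0r mulr0 addr0.
rewrite exprS -[k.+1%:R]natr1 mulrDl mul1r.
move: IH; set ku := k%:R * u => IH ku1.
have u0 := u_ge0.
have ku2 : ku <= 1 / 2 by lra.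
have ku0 : 0 <= ku by rewrite mulr_ge0.
have {}IH := IH ku2.
have : (1 + u) * (1 + u) ^+ k <= (1 + u) * (1 + 2 * ku).
  by rewrite ler_wpM2l // ltW // ltr_wpDr.
have : u * ku <= u * (1 / 2) by rewrite ler_wpM2l.
by lra.
Qed.

Lemma fl_sum_error_linear (N : nat) s v : N%:R * u <= 1 / 2 ->
  (size s <= N)%N -> fl_sum u s v ->
  `|v - \sum_(a <- s) a| <= 2 * (N%:R * u) * \sum_(a <- s) `|a|.
Proof.
move=> Nu sN /fl_sum_error h; apply: (le_trans h).
rewrite ler_wpM2r ?sumr_ge0 // lerBlDl.
apply: le_trans (expr1D_le Nu); rewrite ler_weXn2l // lerDl //.
Qed.

Section Operations.
Variable N : nat.
Hypothesis Nu : N%:R * u <= 1 / 16.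
Hypothesis N2 : (2 <= N)%N.

Let u16 : 2 * u <= 1 / 16.
Proof. by apply: le_trans Nu; rewrite ler_wpM2r // ler_nat. Qed.

Let uNu : 2 * u <= N%:R * u.
Proof. by rewrite ler_wpM2r // ler_nat. Qed.

Lemma fl_products_error (I : Type) (l : seq I) (P : pred I) (p q : I -> R) :
  (forall j, P j -> fl u (q j) (p j)) ->
  `|\sum_(j <- l | P j) (p j - q j)| <= u * \sum_(j <- l | P j) `|q j| /\
  \sum_(j <- l | P j) `|p j| <= 2 * \sum_(j <- l | P j) `|q j|.
Proof.
have u16' := u16; move=> pq; split.
  apply: (le_trans (ler_norm_sum _ _ _)); rewrite mulr_sumr.
  by apply: ler_sum => j /pq /fl_error.
rewrite mulr_sumr; apply: ler_sum => j /pq /fl_error h.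
have := ler_normD (p j - q j) (q j); rewrite subrK.
have : u * `|q j| <= 1 / 2 * `|q j| by rewrite ler_wpM2r //; lra.
by have := normr_ge0 (q j); lra.
Qed.

Lemma fl_mulmx_error m n (B : 'M[R]_(m, n)) v r : (n <= N)%N ->
  fl_mulmx u B v r ->
  enorm (r - B *m v) <= 16 * (N%:R * u) * (frobenius B * enorm v).
Proof.
have Nu16 := Nu; move=> nN Bvr; have Nu0 : 0 <= N%:R * u by rewrite mulr_ge0.
apply: frobenius_bound => [|i]; first by rewrite mulr_ge0.
have [p [pE]] := Bvr i.
have Nu2 : N%:R * u <= 1 / 2 by apply: (le_trans Nu); lra.
move=> /(@fl_sum_error_linear N); rewrite size_map size_enum_ord.
rewrite !(big_map p) !big_enum /= => /(_ Nu2 nN) rE.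
have [e1 e2] := fl_products_error (P := xpredT) (index_enum _)
  (fun j _ => pE j).
rewrite !mxE; set S := \sum_j `|B i j| * `|v j 0|.
have SE : \sum_j `|B i j * v j 0| = S.
  by apply: eq_bigr => j _; rewrite normrM.
move: e1 e2; rewrite SE sumrB => e1 e2.
have S0 : 0 <= S by rewrite -SE sumr_ge0.
have -> : r i 0 - \sum_j B i j * v j 0 =
  (r i 0 - \sum_j p j) + (\sum_j p j - \sum_j B i j * v j 0) by ring.
apply: (le_trans (ler_normD _ _)).
have h1 : 2 * (N%:R * u) * (\sum_j `|p j|) <= 2 * (N%:R * u) * (2 * S).
  by rewrite ler_wpM2l // mulr_ge0.
have u2 := uNu; have h2 : 2 * u * S <= N%:R * u * S by rewrite ler_wpM2r.
have h3 : 0 <= N%:R * u * S by rewrite mulr_ge0.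
by lra.
Qed.

(** Row by row, substitution solves [T z = y] up to a residual entrywise bounded
by [|T| |z|]. The error of the sum also involves [|y_i|], which is at most the
residual plus [(|T| |z|)_i], so that the residual can be absorbed. *)
Lemma fl_subst_error n (P : rel 'I_n) (T : 'M[R]_n) y z : (n < N)%N ->
  (forall i, ~~ P i i) -> (forall i j, ~~ P i j -> j != i -> T i j = 0) ->
  (forall i, T i i != 0) -> fl_subst u P T y z ->
  enorm (y - T *m z) <= 16 * (N%:R * u) * (frobenius T * enorm z).
Proof.
have Nu16 := Nu; have u16' := u16.
move=> nN Pii PT Tii Tyz; have Nu0 : 0 <= N%:R * u by rewrite mulr_ge0.
apply: frobenius_bound => [|i]; first by rewrite mulr_ge0.
have [p [s [pE sE zE]]] := Tyz i.
have [e1 e2] := fl_products_error (enum 'I_n) pE.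
have sz : (size (y i 0%R :: [seq - p j | j <- enum 'I_n & P i j]) <= N)%N.
  rewrite /= size_map size_filter (leq_trans _ nN) // ltnS.
  by rewrite (leq_trans (count_size _ _)) // size_enum_ord.
have Nu2 : N%:R * u <= 1 / 2 by apply: (le_trans Nu); lra.
have := fl_sum_error_linear Nu2 sz sE.
rewrite 2!big_cons !(big_map (fun j => - p j)) !big_filter /=.
under [X in _ <= _ * (_ + X)]eq_bigr do rewrite normrN.
rewrite sumrN; move: e1 e2; rewrite sumrB.
set Sp := \sum_(_ <- _ | _) p _; set Np := \sum_(_ <- _ | _) `|p _|.
set Sq := \sum_(_ <- _ | _) (T i _ * _).
set Nq := \sum_(_ <- _ | _) `|T i _ * _|.
move=> e1 e2 e3.
have Tz : (T *m z) i 0 = T i i * z i 0 + Sq.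
  rewrite mxE (bigD1 i) //= /Sq big_enum_cond /=; congr (_ + _).
  rewrite big_mkcond [RHS]big_mkcond; apply: eq_bigr => j _.
  have [->|ji] := eqVneq j i; first by rewrite (negPf (Pii i)).
  by case: ifPn => // /PT -> //; rewrite mul0r.
set S := \sum_j _.
have SE : S = `|T i i * z i 0| + Nq.
  rewrite /S (bigD1 i) //= normrM /Nq big_enum_cond /=; congr (_ + _).
  rewrite big_mkcond [RHS]big_mkcond; apply: eq_bigr => j _.
  have [->|ji] := eqVneq j i; first by rewrite (negPf (Pii i)).
  by case: ifPn => [_|/PT -> //]; rewrite ?normrM // normr0 mul0r.
have e4 : `|T i i * z i 0 - s| <= 2 * u * `|T i i * z i 0|.
  apply: fl_error_computed; first by lra.
  case: zE => d du ->; exists d => //.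
  by rewrite mulrA [T i i * _]mulrC divfK.
have Nq0 : 0 <= Nq by rewrite sumr_ge0.
have S0 : 0 <= S by rewrite SE addr_ge0.
rewrite mxE mxE Tz; set rho := `|_|.
have yb : `|y i 0| <= rho + S.
  rewrite -[y i 0](subrK (T i i * z i 0 + Sq)).
  apply: (le_trans (ler_normD _ _)); rewrite lerD2l SE.
  by apply: (le_trans (ler_normD _ _)); rewrite lerD2l ler_norm_sum.
have rb : rho <= `|s - (y i 0 - Sp)| + `|Sp - Sq| + `|T i i * z i 0 - s|.
  rewrite /rho -[X in `|X|]opprK normrN.
  have -> : - (y i 0 - (T i i * z i 0 + Sq)) =
    (s - (y i 0 - Sp)) - (Sp - Sq) + (T i i * z i 0 - s) by ring.
  apply: (le_trans (ler_normD _ _)); rewrite lerD2r.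
  by apply: (le_trans (ler_normD _ _)); rewrite normrN.
have f1 : 2 * (N%:R * u) * (`|y i 0| + Np) <=
    2 * (N%:R * u) * (rho + S + 2 * Nq).
  by rewrite ler_wpM2l ?mulr_ge0 // lerD.
have u2 := uNu; have f2 : 2 * u * Nq <= N%:R * u * Nq by rewrite ler_wpM2r.
have f3 : 2 * u * `|T i i * z i 0| <= N%:R * u * `|T i i * z i 0|.
  by rewrite ler_wpM2r.
have f4 : N%:R * u * rho <= 1 / 16 * rho by rewrite ler_wpM2r ?normr_ge0.
have f5 : 0 <= N%:R * u * Nq by rewrite mulr_ge0.
have f6 : 0 <= N%:R * u * `|T i i * z i 0| by rewrite mulr_ge0.
rewrite SE in f1 yb S0 *.
by lra.
Qed.

Lemma fl_trisolve_error n (T : 'M[R]_n) y z : (n < N)%N -> T \in unitmx ->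
  fl_trisolve u T y z ->
  enorm (y - T *m z) <= 16 * (N%:R * u) * (frobenius T * enorm z).
Proof.
move=> nN Tu [[tT h]|[tT h]]; apply: (fl_subst_error nN _ _ _ h) => /=.
- by move=> i; rewrite ltnn.
- move=> i j; rewrite -leqNgt leq_eqVlt => /orP[/eqP/val_inj -> /eqP //|ij _].
  exact: (is_trig_mxP tT).
- move=> i; move: Tu; rewrite unitmxE det_trig // unitfE.
  by move/prodf_neq0/(_ i)/(_ isT).
- by move=> i; rewrite ltnn.
- move=> i j; rewrite -leqNgt leq_eqVlt => /orP[/eqP/val_inj -> /eqP //|ij _].
  by have := is_trig_mxP tT _ _ ij; rewrite mxE.
- move=> i; move: Tu; rewrite -unitmx_tr unitmxE det_trig // unitfE.
  by move/prodf_neq0/(_ i)/(_ isT); rewrite mxE.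
Qed.

Lemma enorm_le_entrywise n k (v w : 'cV[R]_n) : 0 <= k ->
  (forall i, `|v i 0| <= k * `|w i 0|) -> enorm v <= k * enorm w.
Proof.
move=> k0 h; rewrite ler_enorm_bound // !dotE mulr_sumr.
apply: ler_sum => i _; rewrite -!expr2.
rewrite -[v i 0 ^+ 2]real_normK ?num_real //.
rewrite -[w i 0 ^+ 2]real_normK ?num_real //.
by rewrite -exprMn ler_pXn2r ?nnegrE ?mulr_ge0.
Qed.

Lemma fl_sub_error n (v w r : 'cV[R]_n) : fl_sub u v w r ->
  enorm (r - (v - w)) <= u * enorm (v - w).
Proof.
by move=> h; apply: enorm_le_entrywise => // i; have := fl_error (h i);
  rewrite !mxE.
Qed.

Lemma fl_add_error n (v w r : 'cV[R]_n) : u <= 1 / 2 -> fl_add u v w r ->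
  enorm (r - (v + w)) <= 2 * u * enorm r.
Proof.
move=> u2 h; apply: enorm_le_entrywise; first by rewrite mulr_ge0.
by move=> i; have := fl_error_computed u2 (h i); rewrite !mxE.
Qed.

End Operations.
End RoundingErrors.

(** * One refinement step *)

Section RefinementStep.
Variables (R : realType).

Lemma injective_unitmx n (G : 'M[R]_n) :
  (forall v : 'cV[R]_n, G *m v = 0 -> v = 0) -> G \in unitmx.
Proof.
move=> Ginj; rewrite -unitmx_tr -row_free_unit -kermx_eq0.
apply/eqP/row_matrixP => i; rewrite row0; apply: trmx_inj; rewrite trmx0.
suff inj (w : 'rV[R]_n) : w *m G^T = 0 -> w^T = 0.
  by apply: inj; rewrite -row_mul mulmx_ker row0.
by move=> wG; apply: Ginj; rewrite -[G]trmxK -trmx_mul wG trmx0.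
Qed.

(** The real-number part of [refine_step]. The letters stand for norms: [a] and
[t] of the two iterates, [al] of [A (x - p)], [rho] of the residual, [F] of the
preconditioner, [mu] of the preconditioned matrix, [cn] of the vector [c], [d]
of the correction, [rc] of the computed residual, and [e1], ..., [h2] of the
errors of the single operations. The error [h1] and the norm [cn] bound each
other, because the backward error of the triangular solve is relative to its
output; [s * kap <= 1/2] breaks this circle. Since [F] and [1 / mu] may be
large, [F] has to meet a factor [mu] every time. *)
Lemma refinement_step_bounds (P kap u mu F a t al rho e1 e2 rc e3 h1 cn e5 h2 d
    e6 : R) :
  let s := P ^+ 3 * u in
  1 <= P -> 1 <= kap -> 0 < u -> s * kap <= 1 / 2 ->
  0 <= mu -> mu <= P -> 0 <= F -> F * mu <= P ^+ 2 ->
  0 <= a -> 0 <= t -> 0 <= al -> al <= rho -> 0 <= cn ->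
  e1 <= P * u * (P * a) ->
  e2 <= u * (rho + e1) ->
  rc <= rho + e1 + e2 ->
  e3 <= P * u * (P * rc) ->
  h1 <= P * u * (F * cn) ->
  cn <= mu * (al + e1 + e2) + kap * mu * (e3 + h1) ->
  e5 <= P * (kap * u) * cn ->
  h2 <= P * u * (F * d) ->
  d <= t + a + e6 ->
  e6 <= 2 * u * t ->
  e1 + mu * e5 + mu * h2 + e6 <=
    9 * P ^+ 6 * u * (a + t + kap * al + kap ^+ 2 * u * rho) /\
  e2 + e3 + h1 <= 9 * P ^+ 6 * u * (rho + u * a).
Proof.
move=> s P1 k1 u0 sk mu0 muP F0 Fmu a0 t0 al0 alr cn0.
move=> b1 b2 b3 b4 b5 b6 b7 b8 b9 b10.
have P0 : 0 < P by lra.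
have k0 : 0 <= kap by lra.
have rho0 : 0 <= rho by lra.
have P2u : P ^+ 2 * u <= s.
  by rewrite ler_pM2r // [leRHS]exprS ler_peMl // sqr_ge0.
have us : u <= s by rewrite ler_peMl ?exprn_ege1 // ltW.
have s0 : 0 < s by rewrite mulr_gt0 ?exprn_gt0.
have s2 : s <= 1 / 2 by apply: le_trans sk; rewrite ler_peMr // ltW.
(* Q bounds the computed residual up to a constant, and mu * W the norm of the
   preconditioned right-hand side c. *)
pose Q := rho + s * a.
have sa0 : 0 <= s * a by rewrite mulr_ge0 // ltW.
have Q0 : 0 <= Q by rewrite addr_ge0.
have c1 : e1 <= s * a.
  apply: (le_trans b1); have -> : P * u * (P * a) = P ^+ 2 * u * a by ring.
  by rewrite ler_wpM2r.
have uQ : u * Q <= s * Q by rewrite ler_wpM2r.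
have sQ : s * Q <= 1 / 2 * Q by rewrite ler_wpM2r.
have c2 : e2 <= s * Q.
  by apply: (le_trans b2); apply: le_trans uQ; rewrite ler_pM2l // /Q; lra.
have c3 : rc <= 2 * Q by rewrite /Q in c2 sQ Q0 *; lra.
have c4 : e3 <= 2 * (s * Q).
  apply: (le_trans b4); have -> : P * u * (P * rc) = P ^+ 2 * u * rc by ring.
  apply: (@le_trans _ _ (P ^+ 2 * u * (2 * Q))).
    by rewrite ler_wpM2l // mulr_ge0 ?sqr_ge0 // ltW.
  have : P ^+ 2 * u * Q <= s * Q by rewrite ler_wpM2r.
  by lra.
have PF : P * u * F * mu <= s.
  have -> : P * u * F * mu = P * u * (F * mu) by ring.
  have -> : s = P * u * P ^+ 2 by rewrite /s; ring.
  by rewrite ler_wpM2l // mulr_ge0 // ltW.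
have mh1 : mu * h1 <= s * cn.
  apply: (@le_trans _ _ (mu * (P * u * (F * cn)))); first by rewrite ler_wpM2l.
  have -> : mu * (P * u * (F * cn)) = P * u * F * mu * cn by ring.
  by rewrite ler_wpM2r.
have kh1 : kap * mu * h1 <= 1 / 2 * cn.
  rewrite -mulrA; apply: (@le_trans _ _ (kap * (s * cn))).
    by rewrite ler_wpM2l.
  by rewrite mulrA (mulrC kap) ler_wpM2r.
pose W := al + s * a + 3 * (kap * (s * Q)).
have ksQ : s * Q <= kap * (s * Q).
  by rewrite ler_peMl // mulr_ge0 // ltW.
have c5 : cn <= 2 * (mu * W).
  have : mu * (al + e1 + e2) <= mu * (al + s * a + kap * (s * Q)).
    by rewrite ler_wpM2l //; lra.
  have : kap * mu * e3 <= kap * mu * (2 * (s * Q)).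
    by rewrite ler_wpM2l // mulr_ge0.
  by rewrite /W; lra.
have W0 : 0 <= W.
  by rewrite /W !addr_ge0 ?mulr_ge0 // ltW.
have WQ : W <= 3 * Q.
  have : s * kap * Q <= 1 / 2 * Q by rewrite ler_wpM2r.
  by rewrite /W /Q in Q0 *; lra.
have c6 : h1 <= 2 * (s * W).
  apply: (le_trans b5); apply: (@le_trans _ _ (P * u * (F * (2 * (mu * W))))).
    by rewrite ler_wpM2l ?mulr_ge0 ?ler_wpM2l // ltW.
  have -> : P * u * (F * (2 * (mu * W))) = 2 * (P * u * F * mu * W) by ring.
  by rewrite ler_pM2l // ler_wpM2r.
have sWQ : s * W <= s * (3 * Q) by rewrite ler_pM2l.
have sP : s * P ^+ 3 = P ^+ 6 * u by rewrite /s; ring.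
have ssP : s * s = P ^+ 6 * u * u by rewrite /s; ring.
have P31 : 1 <= P ^+ 3 by rewrite exprn_ege1.
have s6 : s <= P ^+ 6 * u by rewrite -sP ler_peMr // ltW.
split; last first.
  have -> : 9 * P ^+ 6 * u * (rho + u * a) =
    9 * (P ^+ 6 * u * rho + P ^+ 6 * u * u * a) by ring.
  rewrite -ssP.
  have : s * rho <= P ^+ 6 * u * rho by rewrite ler_wpM2r.
  by rewrite /Q in c2 c4 sWQ *; lra.
have me5 : mu * e5 <= 2 * (s * (kap * W)).
  apply: (@le_trans _ _ (mu * (P * (kap * u) * (2 * (mu * W))))).
    rewrite ler_wpM2l //; apply: (le_trans b7); rewrite ler_wpM2l //.
    by rewrite !mulr_ge0 // ltW.
  have -> : mu * (P * (kap * u) * (2 * (mu * W))) =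
    2 * (P * u * (mu * mu) * (kap * W)) by ring.
  rewrite ler_pM2l // ler_wpM2r ?mulr_ge0 //.
  have -> : s = P * u * (P * P) by rewrite /s; ring.
  by rewrite ler_pM2l ?mulr_gt0 // ler_pM.
have ut : 2 * u * t <= 2 * (s * t) by rewrite -mulrA ler_pM2l // ler_wpM2r.
have st : s * t <= 1 / 2 * t by rewrite ler_wpM2r.
have dta : d <= 2 * t + a by lra.
have mh2 : mu * h2 <= s * (2 * t + a).
  apply: (@le_trans _ _ (mu * (P * u * (F * (2 * t + a))))).
    rewrite ler_wpM2l //; apply: (le_trans b8).
    by rewrite ler_wpM2l ?ler_wpM2l ?mulr_ge0 // ltW.
  have -> : mu * (P * u * (F * (2 * t + a))) = P * u * F * mu * (2 * t + a).
    by ring.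
  by rewrite ler_wpM2r // addr_ge0 // mulr_ge0.
have kW : 2 * (kap * W) <= 2 * (kap * al) + 3 * a + 6 * (kap ^+ 2 * s * rho).
  have -> : kap * W = kap * al + (s * kap) * a + 3 * (kap ^+ 2 * s * rho)
      + 3 * ((s * kap) * (s * kap) * a) by rewrite /W /Q; ring.
  have h : (s * kap) * a <= 1 / 2 * a by rewrite ler_wpM2r.
  have : (s * kap) * (s * kap) * a <= 1 / 2 * (1 / 2) * a.
    by rewrite ler_wpM2r // ler_pM // mulr_ge0 // ltW.
  by lra.
have skW : s * (2 * (kap * W)) <=
    s * (2 * (kap * al) + 3 * a + 6 * (kap ^+ 2 * s * rho)).
  by rewrite ler_pM2l.
have -> : 9 * P ^+ 6 * u * (a + t + kap * al + kap ^+ 2 * u * rho) =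
  9 * (P ^+ 6 * u * (a + t + kap * al) + P ^+ 6 * u * u * (kap ^+ 2 * rho)).
  by ring.
rewrite -ssP.
have atk0 : 0 <= a + t + kap * al by rewrite !addr_ge0 // mulr_ge0.
have : s * (a + t + kap * al) <= P ^+ 6 * u * (a + t + kap * al).
  by rewrite ler_wpM2r.
have : 0 <= s * t by rewrite mulr_ge0 // ltW.
have : 0 <= s * (kap * al) by rewrite !mulr_ge0 // ltW.
have : 0 <= s * s * (kap ^+ 2 * rho) by rewrite !mulr_ge0 ?sqr_ge0 // ltW.
by lra.
Qed.

(** [P] dominates all polynomial prefactors, and [mu] is a bound for the norm of
the preconditioned matrix [M]. *)
Variables (m n : nat) (A : 'M[R]_(m, n)) (b : 'cV[R]_m) (x : 'cV[R]_n).
Variables (Rh : 'M[R]_n) (solver : 'cV[R]_n -> 'cV[R]_n).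
Variables (u P kap mu : R).
Let M := A *m invmx Rh.
Hypothesis u0 : 0 < u.
Hypothesis kap1 : 1 <= kap.
Variable N : nat.
Hypothesis mN : (m <= N)%N.
Hypothesis nN : (n < N)%N.
Hypothesis N2 : (2 <= N)%N.
Hypothesis PN : 16 * N%:R <= P.
Hypothesis small : P ^+ 3 * u * kap <= 1 / 2.
Hypothesis A1 : forall v, enorm (A *m v) <= enorm v.
Hypothesis Akap : forall v, enorm v <= kap * enorm (A *m v).
Hypothesis AF : frobenius A <= P.
Hypothesis Rhu : Rh \in unitmx.
Hypothesis mu0 : 0 <= mu.
Hypothesis muP : mu <= P.
Hypothesis Mmu : forall v, enorm (M *m v) <= mu * enorm v.
Hypothesis RF : frobenius Rh * mu <= P ^+ 2.
Hypothesis solverP : forall c,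
  enorm (solver c - invmx ((invmx Rh)^T *m A^T *m A *m invmx Rh) *m c)
    <= P * (kap * u) * enorm c.
Hypothesis ls : A^T *m (b - A *m x) = 0.

(** The effect of one refinement step on the normal equations. Exact arithmetic
would give [A^T A (x - q) = 0]. Rounding leaves two kinds of errors: those made
on the side of [A], that is in [A p], in the inner solver, in the last
triangular solve and in the update, appear behind a factor [A^T] and are
collected in [f]; those made in the residual, in the product with [A^T] and in
the first triangular solve are of the size of [u] times the residual, up to
terms [u^2 |p|], and are collected in [g]. The inner solver enters
through [A^T A R^-1 = R^T M^T M], which turns its exact solution into
[R^T c]. *)
Lemma refine_step p q : fl_refine u A b Rh solver p q ->
  exists f g, [/\ A^T *m (A *m (x - q)) = A^T *m f + g,
    enorm f <= 9 * P ^+ 6 * u *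
      (enorm p + enorm q + kap * enorm (A *m (x - p)) +
       kap ^+ 2 * u * enorm (b - A *m p)) &
    enorm g <= 9 * P ^+ 6 * u * (enorm (b - A *m p) + u * enorm p)].
Proof.
move=> [Ax [r [g [c [d [[mul1 sub mul2] [tri1 tri2 add]]]]]]].
have N2r : 2 <= N%:R :> R by rewrite ler_nat.
have P1 : 1 <= P by move: PN N2r; lra.
have P0 : 0 <= P by move: P1; lra.
have u0w : 0 <= u by exact: ltW.
have Nu : N%:R * u <= 1 / 16.
  have : P * u <= P ^+ 3 * u.
    rewrite ler_pM2r // -[X in X <= _]expr1; apply: ler_weXn2l => //.
  have : P ^+ 3 * u <= P ^+ 3 * u * kap.
    by rewrite ler_peMr // mulr_ge0 ?exprn_ge0.
  have : 16 * N%:R * u <= P * u by rewrite ler_pM2r.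
  by move: small; lra.
have op (F e X v : R) : e <= 16 * (N%:R * u) * (X * v) ->
    0 <= v -> 0 <= X -> X <= F -> e <= P * u * (F * v).
  move=> h v0 X0 XF; apply: (le_trans h); apply: ler_pM.
  - by rewrite !mulr_ge0.
  - by rewrite mulr_ge0.
  - by rewrite mulrA ler_wpM2r.
  - by rewrite ler_wpM2r.
set rho := b - A *m p.
pose E1 := A *m p - Ax; pose E2 := r - (b - Ax).
pose e3 := g - A^T *m r; pose h1 := Rh^T *m c - g.
pose h2 := Rh *m d - solver c; pose e6 := q - (p + d).
pose y := invmx ((invmx Rh)^T *m A^T *m A *m invmx Rh) *m c.
pose e5 := solver c - y.
have b1 : enorm E1 <= P * u * (P * enorm p).
  have := fl_mulmx_error u0w Nu N2 (ltnW nN) mul1; rewrite -enormN opprB => /op.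
  by apply; rewrite ?enorm_ge0 ?frobenius_ge0.
have rE : r = rho + E1 + E2.
  by apply/colP => i; rewrite /rho /E1 /E2 !mxE; ring.
have bAx : b - Ax = rho + E1.
  by apply/colP => i; rewrite /rho /E1 !mxE; ring.
have b2 : enorm E2 <= u * (enorm rho + enorm E1).
  apply: (le_trans (fl_sub_error u0w sub)); rewrite ler_pM2l // bAx.
  exact: enormD.
have b3 : enorm r <= enorm rho + enorm E1 + enorm E2.
  by rewrite {1}rE (le_trans (enormD _ _)) // lerD2r enormD.
have b4 : enorm e3 <= P * u * (P * enorm r).
  have := fl_mulmx_error u0w Nu N2 mN mul2; rewrite -/e3 frobenius_tr => /op.
  by apply; rewrite ?enorm_ge0 ?frobenius_ge0.
have b5 : enorm h1 <= P * u * (frobenius Rh * enorm c).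
  have := fl_trisolve_error u0w Nu N2 nN _ tri1; rewrite unitmx_tr => /(_ Rhu).
  rewrite -enormN opprB -/h1 frobenius_tr => /op.
  by apply; rewrite ?enorm_ge0 ?frobenius_ge0.
have b7 : enorm e5 <= P * (kap * u) * enorm c by exact: solverP.
have b8 : enorm h2 <= P * u * (frobenius Rh * enorm d).
  have := fl_trisolve_error u0w Nu N2 nN Rhu tri2.
  rewrite -enormN opprB -/h2 => /op.
  by apply; rewrite ?enorm_ge0 ?frobenius_ge0.
have b10 : enorm e6 <= 2 * u * enorm q.
  apply: fl_add_error => //.
  have : u <= N%:R * u by rewrite ler_peMl // ler1n ltnW.
  by move: Nu; lra.
have b9 : enorm d <= enorm q + enorm p + enorm e6.
  have -> : d = q - p - e6 by apply/colP => i; rewrite /e6 !mxE; ring.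
  by rewrite (le_trans (enormB _ _)) // lerD2r enormB.
have ARM : A = M *m Rh by rewrite mulmxKV.
have ATM : A^T = Rh^T *m M^T by rewrite -trmx_mul -ARM.
have RTK : (invmx Rh)^T *m Rh^T = 1%:M by rewrite -trmx_mul mulmxV // trmx1.
have MTA : M^T = (invmx Rh)^T *m A^T by rewrite trmx_mul.
have ri : rho = (b - A *m x) + A *m (x - p).
  by rewrite mulmxBr addrA subrK.
have Arho : A^T *m rho = A^T *m (A *m (x - p)) by rewrite ri mulmxDr ls add0r.
have alrho : enorm (A *m (x - p)) <= enorm rho.
  have [->|nz] := eqVneq (enorm (A *m (x - p))) 0; first exact: enorm_ge0.
  have zp : 0 < enorm (A *m (x - p)) by rewrite lt_def nz enorm_ge0.
  rewrite -(ler_pM2l zp) -expr2 enorm_sqr dot_mulmx -Arho -dot_mulmx.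
  exact: le_trans (ler_norm _) (cauchy_schwarz _ _).
have Rc : Rh^T *m c = A^T *m r + e3 + h1.
  by rewrite /e3 /h1 [A^T *m r + _]addrC subrK [g + _]addrC subrK.
clearbody rho E1 E2 e3 h1.
have cE : c = M^T *m (A *m (x - p) + E1 + E2) + (invmx Rh)^T *m (e3 + h1).
  have Ar : A^T *m r = A^T *m (A *m (x - p) + E1 + E2).
    by rewrite [in LHS]rE -!addrA 2!mulmxDr Arho -mulmxDr -mulmxDr.
  rewrite MTA -mulmxA -Ar -mulmxDr addrA -Rc mulmxA RTK.
  by rewrite mul1mx.
have MT := enorm_mulmx_tr mu0 Mmu.
have k0 : 0 <= kap by move: kap1; lra.
have Rinv w : enorm ((invmx Rh)^T *m w) <= kap * mu * enorm w.
  apply: enorm_mulmx_tr => [|v]; first by rewrite mulr_ge0.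
  apply: (le_trans (Akap _)); rewrite -mulrA ler_wpM2l // mulmxA.
  exact: Mmu.
have b6 : enorm c <= mu * (enorm (A *m (x - p)) + enorm E1 + enorm E2) +
    kap * mu * (enorm e3 + enorm h1).
  rewrite {1}cE (le_trans (enormD _ _)) // lerD //.
    apply: (le_trans (MT _)); rewrite ler_wpM2l //.
    by rewrite (le_trans (enormD _ _)) // lerD2r enormD.
  by apply: (le_trans (Rinv _)); rewrite ler_wpM2l ?mulr_ge0 ?enormD.
have [fb gb] := refinement_step_bounds P1 kap1 u0 small mu0 muP
  (frobenius_ge0 Rh) RF
  (enorm_ge0 p) (enorm_ge0 q) (enorm_ge0 _) alrho (enorm_ge0 c)
  b1 b2 b3 b4 b5 b6 b7 b8 b9 b10.
have Gu : (invmx Rh)^T *m A^T *m A *m invmx Rh \in unitmx.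
  apply: injective_unitmx => v; rewrite -MTA -mulmxA -/M -mulmxA => Gv.
  have Mv : M *m v = 0.
    by apply/eqP; rewrite -enorm_eq0 -sqrf_eq0 enorm_sqr dot_mulmx Gv dot0r.
  have := Akap (invmx Rh *m v); rewrite mulmxA -/M Mv.
  have -> : enorm (0 : 'cV[R]_m) = 0 by apply/eqP; rewrite enorm_eq0.
  rewrite mulr0 => vn; have /eqP : enorm (invmx Rh *m v) == 0.
    by rewrite eq_le vn enorm_ge0.
  move/eqP; rewrite enorm_eq0 => /eqP Rv.
  by rewrite -[v](mulKVmx Rhu) Rv mulmx0.
have My : Rh^T *m (M^T *m (M *m y)) = Rh^T *m c.
  congr (_ *m _); rewrite mulmxA MTA /M !mulmxA.
  by rewrite mulmxV // mul1mx.
have Ad : A^T *m (A *m d) =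
    A^T *m r + e3 + h1 + A^T *m (M *m e5) + A^T *m (M *m h2).
  have -> : A *m d = M *m y + M *m e5 + M *m h2.
    rewrite {1}ARM -mulmxA -!mulmxDr; congr (_ *m _).
    by rewrite /e5 /h2 [y + _]addrC subrK addrC subrK.
  by rewrite !mulmxDr {1}ATM -mulmxA My Rc.
have xq : x - q = x - p - d - e6.
  by apply/colP => i; rewrite /e6 !mxE; ring.
clearbody e5 h2 e6.
exists (- (E1 + M *m e5 + M *m h2 + A *m e6)), (- (A^T *m E2 + e3 + h1)).
split.
- rewrite xq (mulmxBr A _ e6) (mulmxBr A _ d).
  rewrite (mulmxBr A^T _ (A *m e6)) (mulmxBr A^T _ (A *m d)) -Arho Ad rE.
  rewrite !(mulmxN, mulmxDr).
  move: (A^T *m _) (A^T *m _) (A^T *m _) (A^T *m _) (A^T *m _) (A^T *m _).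
  move=> v1 v2 v3 v4 v5 v6; apply/colP => i.
  by rewrite !mxE; ring.
- rewrite enormN; apply: le_trans fb.
  rewrite (le_trans (enormD _ _)) // lerD ?A1 //.
  rewrite (le_trans (enormD _ _)) // lerD ?Mmu //.
  by rewrite (le_trans (enormD _ _)) // lerD ?Mmu.
rewrite enormN; apply: le_trans gb.
rewrite (le_trans (enormD _ _)) // lerD2r (le_trans (enormD _ _)) // lerD2r.
have A1' v : enorm (A *m v) <= 1 * enorm v by rewrite mul1r.
by have := enorm_mulmx_tr ler01 A1' E2; rewrite mul1r.
Qed.

End RefinementStep.

(** * The two iterates *)

Section Scalars.
Variable R : realType.

(** The initialization has an error [al0] of the order of the optimal residual
[rho]. The refinement step multiplies it by [kap u], and what remains is the
strong forward error; the term with [kap * al1] that enters through the norm of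
the new iterate is absorbed on the left. *)
Lemma first_iterate_bound (P K kap u a rho a0 a1 al0 al1 rho0 f g : R) :
  1 <= P -> P <= K -> 1 <= kap -> 0 < u -> K * (kap * u) <= 1 / 2 ->
  0 <= a -> 0 <= rho -> 0 <= a0 -> 0 <= rho0 -> 0 <= al1 ->
  al0 <= P * (rho + a * u) -> a0 <= a + kap * al0 -> a1 <= a + kap * al1 ->
  rho0 <= rho + al0 ->
  f <= K * u * (a0 + a1 + kap * al0 + kap ^+ 2 * u * rho0) ->
  g <= K * u * (rho0 + u * a0) ->
  al1 <= f + kap * g ->
  al1 <= 16 * P * K * u * (a + kap * rho).
Proof.
move=> P1 PK k1 u0 Kz a_0 r_0 a0_0 r0_0 al1_0 b1 b2 b3 b4 bf bg b5.
have k0 : 0 < kap by lra.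
have K1 : 1 <= K by lra.
pose z := kap * u; have z0 : 0 < z by rewrite mulr_gt0.
have Pz : P * z <= 1 / 2 by apply: le_trans Kz; rewrite ler_pM2r.
have z2 : z <= 1 / 2 by apply: le_trans Kz; rewrite ler_peMl // ltW.
have c1 : kap * al0 <= P * (kap * rho) + 1 / 2 * a.
  apply: (@le_trans _ _ (kap * (P * (rho + a * u)))); first by rewrite ler_pM2l.
  have : P * z * a <= 1 / 2 * a by rewrite ler_wpM2r.
  by rewrite /z; lra.
have kr0 : 0 <= kap * rho by rewrite mulr_ge0 // ltW.
have Pkr : kap * rho <= P * (kap * rho) by rewrite ler_peMl.
have c2 : kap * rho0 <= 2 * (P * (kap * rho)) + 1 / 2 * a.
  have : kap * rho0 <= kap * (rho + al0) by rewrite ler_pM2l.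
  by lra.
have za0 : z * a0 <= 1 / 2 * a0 by rewrite ler_wpM2r.
have zr0 : z * (kap * rho0) <= 1 / 2 * (kap * rho0).
  by rewrite ler_wpM2r // mulr_ge0 // ltW.
have aP : a <= P * a by rewrite ler_peMl.
have Ku0 : 0 < K * u by rewrite mulr_gt0 //; lra.
have c3 : al1 <= K * u * (8 * (P * (a + kap * rho)) + kap * al1).
  apply: (@le_trans _ _ (K * u * (a0 + a1 + kap * al0 + z * (kap * rho0)
    + kap * rho0 + z * a0))).
    have : kap * g <= kap * (K * u * (rho0 + u * a0)) by rewrite ler_pM2l.
    by rewrite /z; lra.
  by rewrite ler_pM2l //; lra.
have : K * (kap * u) * al1 <= 1 / 2 * al1 by rewrite ler_wpM2r.
by lra.
Qed.

(** Here the non-pathological assumption enters, as the bound of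
[a + kap * (a + kap * rho) * u] by [P * t], with [t] the norm of the computed
solution. After the first step, [kap * al1] and [kap ^+ 2 * u * rho1] are
bounded by multiples of the same quantity, so the error [f] of the second step
is relative to [t]. The error [g] is relative to the residual
[H] except for terms [u * t], which are dominated by [H] when the residual is
not already negligible. *)
Lemma second_iterate_bounds (P K L kap u a rho a1 al1 rho1 t H f g : R) :
  1 <= P -> 1 <= K -> K <= L -> 1 <= kap -> 0 < u -> L * (kap * u) <= 1 / 2 ->
  0 <= a -> 0 <= rho -> 0 <= t -> 0 <= al1 ->
  al1 <= L * u * (a + kap * rho) ->
  a + kap * (a + kap * rho) * u <= P * t ->
  a1 <= a + kap * al1 -> rho1 <= rho + al1 -> rho <= H ->
  f <= K * u * (a1 + t + kap * al1 + kap ^+ 2 * u * rho1) ->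
  g <= K * u * (rho1 + u * a1) ->
  f <= 6 * K * L * P * u * t /\
  (8 * (6 * K * L * P * u) * t <= H -> g <= 6 * K * L * P * u * H).
Proof.
move=> P1 K1 KL k1 u0 Lz a_0 r_0 t_0 al1_0 b1 b2 b3 b4 b5 bf bg.
have k0 : 0 < kap by lra.
have L1 : 1 <= L by lra.
pose z := kap * u; have z0 : 0 < z by rewrite mulr_gt0.
have z2 : z <= 1 / 2 by apply: le_trans Lz; rewrite ler_peMl // ltW.
have Ku0 : 0 < K * u by rewrite mulr_gt0 //; lra.
have h1 : 0 <= kap * (a + kap * rho) * u.
  by rewrite !mulr_ge0 ?addr_ge0 ?mulr_ge0 // ltW.
have aPt : a <= P * t by lra.
have c1 : kap * al1 <= L * (P * t).
  apply: (@le_trans _ _ (kap * (L * u * (a + kap * rho)))).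
    by rewrite ler_pM2l.
  have -> : kap * (L * u * (a + kap * rho)) = L * (kap * (a + kap * rho) * u).
    by ring.
  by rewrite ler_pM2l; lra.
have Pt0 : 0 <= P * t by rewrite mulr_ge0 //; lra.
have LPt : P * t <= L * (P * t) by rewrite ler_peMl.
have tPt : t <= P * t by rewrite ler_peMl.
have zr : z * (kap * rho) <= P * t.
  have : 0 <= z * a by rewrite mulr_ge0 // ltW.
  by rewrite /z in b2 *; lra.
have zal : z * (kap * al1) <= 1 / 2 * (kap * al1).
  by rewrite ler_wpM2r // mulr_ge0 // ltW.
have c2 : z * (kap * rho1) <= 2 * (L * (P * t)).
  have : z * (kap * rho1) <= z * (kap * (rho + al1)).
    by rewrite ler_pM2l // ler_pM2l.
  by lra.
have c3 : a1 <= 2 * (L * (P * t)) by lra.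
split.
  apply: (le_trans bf).
  have -> : 6 * K * L * P * u * t = K * u * (6 * (L * (P * t))).
    by ring.
  rewrite ler_pM2l //; have -> : kap ^+ 2 * u * rho1 = z * (kap * rho1).
    by rewrite /z; ring.
  by lra.
move=> big.
have H0 : 0 <= H by lra.
have uLPt : u * (L * (P * t)) <= 1 / 48 * H.
  have : u * (L * (P * t)) <= K * (u * (L * (P * t))).
    by rewrite ler_peMl // !mulr_ge0 //; lra.
  by lra.
have c4 : al1 <= 1 / 2 * H + u * (L * (P * t)).
  apply: (le_trans b1).
  have : L * u * a <= L * u * (P * t) by rewrite ler_wpM2l // mulr_ge0 //; lra.
  have : L * (kap * u) * rho <= 1 / 2 * rho by rewrite ler_wpM2r.
  by lra.
have c5 : u * a1 <= u * (2 * (L * (P * t))) by rewrite ler_pM2l.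
apply: (le_trans bg).
have -> : 6 * K * L * P * u * H = K * u * (6 * (L * (P * H))) by ring.
rewrite ler_pM2l //.
have : 1 * H <= L * P * H by rewrite ler_wpM2r // mulr_ege1.
by lra.
Qed.

End Scalars.

(** * Polynomial prefactors *)

Section Prefactors.
Variable R : realType.
Implicit Types c d : nat -> nat -> R.

Lemma prefactor_const (a : R) : 0 < a -> prefactor (fun _ _ => a).
Proof. by move=> a0; split=> //; exists a%:P%:P => m n; rewrite !hornerC. Qed.

Lemma prefactor_dims : prefactor (fun m n => (m + n + 2)%:R : R).
Proof.
split=> [|m n _ _]; last by rewrite ltr0n addn_gt0 orbT.
exists ('X + 'X%:P + 2%:P%:P) => m n.
by rewrite !(hornerD, hornerX, hornerC) !natrD.
Qed.

Lemma prefactorD c d :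
  prefactor c -> prefactor d -> prefactor (fun m n => c m n + d m n).
Proof.
move=> [[p pE] c0] [[q qE] d0]; split=> [|m n m0 n0].
  by exists (p + q) => m n; rewrite !hornerD pE qE.
by rewrite addr_gt0 ?c0 ?d0.
Qed.

Lemma prefactorM c d :
  prefactor c -> prefactor d -> prefactor (fun m n => c m n * d m n).
Proof.
move=> [[p pE] c0] [[q qE] d0]; split=> [|m n m0 n0].
  by exists (p * q) => m n; rewrite !hornerM pE qE.
by rewrite mulr_gt0 ?c0 ?d0.
Qed.

Lemma prefactorX c k : prefactor c -> prefactor (fun m n => c m n ^+ k).
Proof.
move=> [[p pE] c0]; split=> [|m n m0 n0]; last by rewrite exprn_gt0 ?c0.
by exists (p ^+ k) => m n; rewrite !horner_exp pE.
Qed.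

End Prefactors.

(** * The two stability results *)

Theorem theorem6p10 (R : realType) (C : R) (cB cC cD cN : nat -> nat -> R)
    (cB_pref : prefactor cB) (cC_pref : prefactor cC)
    (cD_pref : prefactor cD) (cN_pref : prefactor cN) :
  exists cA cF cS : nat -> nat -> R,
  [/\ prefactor cA, prefactor cF, prefactor cS &
  forall (m n : nat) (A : 'M[R]_(m, n)) (b : 'cV[R]_m) (x : 'cV[R]_n) (u : R)
    (Rh : 'M[R]_n) (solver : 'cV[R]_n -> 'cV[R]_n) (x0 x1 x2 : 'cV[R]_n),
  let kappa := cond A in
  (n <= m)%N ->
  spectral_norm A = 1 ->
  enorm b = 1 ->
  lsq_solution A b x ->
  0 < u ->
  fl_refine u A b Rh solver x0 x1 ->
  fl_refine u A b Rh solver x1 x2 ->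
  (* (A), with finite kappa *)
  0 < sigma_min A ->
  kappa * u <= 1 / cA m n ->
  (* (B) *)
  enorm x + kappa * (enorm x + kappa * enorm (b - A *m x)) * u
    <= cB m n * enorm x2 ->
  (* (C') *)
  triangular Rh ->
  Rh \in unitmx ->
  cond (A *m invmx Rh) <= C ->
  enorm (A *m (x - x0)) <= cC m n * (enorm (b - A *m x) + enorm x * u) ->
  (* scaling of the preconditioner presupposed by (D) *)
  spectral_norm (A *m invmx Rh) <= cN m n ->
  (* (D) *)
  (forall c : 'cV[R]_n,
     enorm (solver c -
            invmx ((invmx Rh)^T *m A^T *m A *m invmx Rh) *m c)
     <= cD m n * (kappa * u) * enorm c) ->
  strongly_forward_stable (cF m n) u A b x x1 /\
  backward_stable (cS m n) u A b x2].
Proof.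
pose P m n : R := 16 * (m + n + 2)%:R + (C ^+ 2 + 1) + (cB m n + cC m n)
  + (cD m n + cN m n).
(* C^2 + 1 exceeds C and is positive whatever the sign of C. *)
have C21 : 0 < C ^+ 2 + 1 by rewrite ltr_wpDl ?sqr_ge0.
have P_pref : prefactor P.
  apply: prefactorD; last exact: prefactorD.
  apply: prefactorD; last exact: prefactorD.
  apply: prefactorD; last exact: prefactor_const.
  by apply: prefactorM; [exact: prefactor_const|exact: prefactor_dims].
have Ppow (a : R) k : 0 < a -> prefactor (fun m n => a * P m n ^+ k).
  by move=> a0; apply: prefactorM; [exact: prefactor_const|exact: prefactorX].
(* With K = 9 P^6 the constant of one step, the first iterate is forward stable
   with L = 16 P K = 144 P^7, the second splits with a = 6 K L P u, and
   backward_error_split gives 12 a. Smallness means 2 L kappa u <= 1. *)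
exists (fun m n => 288 * P m n ^+ 7), (fun m n => 144 * P m n ^+ 7),
  (fun m n => (12 * 6 * 9 * 144) * P m n ^+ 14).
split; [by apply: Ppow; rewrite ?mulr_gt0..|].
move=> m n A b x u Rh solver x0 x1 x2 kap nm sA nb ls u0 ref1 ref2 smA.
move=> hA hB _ Rhu hC hC' hN hD.
have n0 := spectral_norm1_dim sA.
have m0 : (0 < m)%N by apply: leq_trans nm.
move: (cB_pref.2 _ _ m0 n0) (cC_pref.2 _ _ m0 n0) => cB0 cC0.
move: (cD_pref.2 _ _ m0 n0) (cN_pref.2 _ _ m0 n0) => cD0 cN0.
have dims : 2 <= (m + n + 2)%:R :> R by rewrite ler_nat leq_addl.
have dn : n%:R <= (m + n + 2)%:R :> R.
  by rewrite ler_nat -addnA addnCA leq_addr.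
have C2 : C <= C ^+ 2 + 1.
  by have := sqr_ge0 (C - 1); have := sqr_ge0 C; clear; lra.
have {Ppow P_pref} [p pE] : exists p, P m n = p by exists (P m n).
rewrite pE in hA *.
move: pE; rewrite /P; move: dims dn; set d := (m + n + 2)%:R => dims dn pE.
have [[p1 pd pC pn] [pB pC' pD pN]] :
    [/\ 1 <= p, 16 * d <= p, C <= p & n%:R <= p] /\
    [/\ cB m n <= p, cC m n <= p, cD m n <= p & cN m n <= p].
  by clear -pE dims dn C21 C2 cB0 cC0 cD0 cN0; split; split; lra.
clear pE P.
have p0 : 0 < p by exact: lt_le_trans p1.
have smA1 : sigma_min A <= 1 by rewrite -sA; apply: sigma_min_le_max.
have kapE : kap = (sigma_min A)^-1.
  by rewrite /kap /cond -/(spectral_norm A) sA mul1r.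
have kap1 : 1 <= kap by rewrite kapE invf_ge1.
have k0 : 0 < kap by exact: lt_le_trans kap1.
have A1 v : enorm (A *m v) <= enorm v.
  by have := enorm_mulmx_sigma_max A v n0; rewrite -/(spectral_norm A) sA mul1r.
have Ak v : enorm v <= kap * enorm (A *m v).
  by rewrite kapE ler_pdivlMl // sigma_min_mulmx_enorm.
have ne : A^T *m (b - A *m x) = 0 by exact: lsq_normal_equations.
set M := A *m invmx Rh in hC hN.
have sM : 0 < sigma_min M by exact: sigma_min_invmx_gt0.
have mu0 : 0 <= sigma_max M.
  by apply: le_trans (sigma_min_le_max M n0); apply: ltW.
have RF : frobenius Rh * sigma_max M <= p ^+ 2.
  apply: (le_trans (frobenius_precond n0 sA sM Rhu)); rewrite expr2.
  have c0 : 0 <= cond M := divr_ge0 mu0 (ltW sM).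
  have cp := le_trans hC pC; move: (cond M) c0 cp => c c0 cp.
  by rewrite ler_pM ?ler0n.
have AF : frobenius A <= p.
  apply: le_trans pn; rewrite -[leRHS]mulr1.
  by apply: frobenius_le_op => // v; rewrite mul1r.
have hsol c : enorm (solver c -
    invmx ((invmx Rh)^T *m A^T *m A *m invmx Rh) *m c)
    <= p * (kap * u) * enorm c.
  apply: (le_trans (hD c)); rewrite ler_wpM2r ?enorm_ge0 // ler_wpM2r //.
  by rewrite mulr_ge0 // ltW.
have ku0 : 0 < kap * u by rewrite mulr_gt0.
have [K KE] : exists K, K = 9 * p ^+ 6 by exists (9 * p ^+ 6).
have [L LE] : exists L, L = 144 * p ^+ 7 by exists (144 * p ^+ 7).
have LK : L = 16 * p * K by rewrite LE KE; ring.
have K1 : 1 <= K by rewrite KE mulr_ege1 ?exprn_ege1 // ler1n.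
have p3K : p ^+ 3 <= K.
  rewrite KE; apply: (@le_trans _ _ (p ^+ 6)); first exact: ler_weXn2l.
  by rewrite ler_peMl ?ler1n // exprn_ge0 // ltW.
have pK : p <= K.
  by apply: le_trans p3K; rewrite -[leLHS]expr1; apply: ler_weXn2l.
have KL : K <= L.
  rewrite LK ler_peMl //; first exact: le_trans K1.
  by rewrite mulr_ege1 // ler1n.
have hz : L * (kap * u) <= 1 / 2.
  move: hA; rewrite ler_pdivlMr ?mulr_gt0 ?exprn_gt0 //.
  have -> : 288 * p ^+ 7 = 2 * L by rewrite LE; ring.
  by rewrite -/kap; clear; lra.
have small X : X <= L -> X * (kap * u) <= 1 / 2.
  by move=> XL; apply: le_trans hz; rewrite ler_pM2r.
have small3 : p ^+ 3 * u * kap <= 1 / 2.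
  by rewrite -mulrA [u * kap]mulrC small // (le_trans p3K).
have mN : (m <= m + n + 2)%N by rewrite -addnA leq_addr.
have nN : (n < m + n + 2)%N.
  by rewrite -addnA addnCA -[X in (X < _)%N]addn0 ltn_add2l addn_gt0 orbT.
have N2 : (2 <= m + n + 2)%N by rewrite leq_addl.
have step := refine_step u0 kap1 mN nN N2 pd small3 A1 Ak AF Rhu mu0
  (le_trans hN pN) (fun v => enorm_mulmx_sigma_max M v n0) RF hsol ne.
rewrite -KE in step.
have dist v w : enorm v <= enorm w + kap * enorm (A *m (w - v)).
  rewrite -{1}[v](subKr w) (le_trans (enormB _ _)) // lerD2l; exact: Ak.
have resid v : enorm (b - A *m v) <= enorm (b - A *m x) + enorm (A *m (x - v)).
  have -> : b - A *m v = (b - A *m x) + A *m (x - v).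
    by rewrite mulmxBr addrA subrK.
  exact: enormD.
have [f1 [g1 [E1 bf1 bg1]]] := step _ _ ref1.
have al1 : enorm (A *m (x - x1)) <=
    L * u * (enorm x + kap * enorm (b - A *m x)).
  rewrite LK; apply: (first_iterate_bound p1 pK kap1 u0 (small _ KL)
    (enorm_ge0 _) (enorm_ge0 _) (enorm_ge0 x0) (enorm_ge0 _) (enorm_ge0 _)
    _ (dist x0 x) (dist x1 x) (resid x0) bf1 bg1).
    by apply: (le_trans hC'); rewrite ler_wpM2r // addr_ge0 ?mulr_ge0 //
      ?enorm_ge0 // ltW.
  exact: gram_bound (ltW k0) Ak E1.
split.
  have al0 := le_trans (enorm_ge0 _) al1.
  have le223 (X e : R) : 0 <= X * e -> X * e <= 223 / 100 * X * e.
    by clear; lra.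
  have Lu0 := mulr_ge0 (le_trans ler01 (le_trans K1 KL)) (ltW u0).
  exists (L * u); rewrite sA divr1 mul1r -/kap -LE lexx Lu0.
  move: (enorm x + kap * enorm (b - A *m x)) al1 al0 => Y al1 al0; split=> //.
    apply: (le_trans (Ak _)); apply: (le_trans (ler_wpM2l (ltW k0) al1)).
    rewrite -[223 / 100 * kap * Y]mulrA.
    have -> : kap * (L * u * Y) = kap * Y * (L * u) by ring.
    by apply: le223; rewrite -mulrA mulr_ge0 ?(ltW k0) // mulrC.
  by apply: (le_trans al1); rewrite mulrC; apply: le223; rewrite mulrC.
have [f2 [g2 [E2 bf2 bg2]]] := step _ _ ref2.
have hB' : enorm x + kap * (enorm x + kap * enorm (b - A *m x)) * u <=
    p * enorm x2.
  by apply: (le_trans hB); rewrite ler_wpM2r ?enorm_ge0.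
have [fb gb] := second_iterate_bounds p1 K1 KL kap1 u0 hz (enorm_ge0 _)
  (enorm_ge0 _) (enorm_ge0 x2) (enorm_ge0 _) al1 hB' (dist x1 x) (resid x1)
  (ls x2) bf2 bg2.
(* A vanishing x2 forces x = 0 by assumption (B); the residual is then b, and
   the term kappa^2 u of (B) cannot vanish. *)
have x20 : x2 != 0.
  apply/eqP => z; move: hB'; rewrite z.
  have -> : enorm (0 : 'cV[R]_n) = 0 by apply/eqP; rewrite enorm_eq0.
  have xn := enorm_ge0 x; have rn := enorm_ge0 (b - A *m x).
  have : 0 <= kap * (enorm x + kap * enorm (b - A *m x)) * u.
    have kr := mulr_ge0 (ltW k0) rn.
    exact: mulr_ge0 (mulr_ge0 (ltW k0) (addr_ge0 xn kr)) (ltW u0).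
  rewrite mulr0 => h1 h2.
  have x_0 : enorm x = 0.
    by apply/eqP; rewrite eq_le xn andbT (le_trans _ h2) // lerDl.
  have : enorm (b - A *m x) = 1.
    move/eqP: x_0; rewrite enorm_eq0 => /eqP ->; by rewrite mulmx0 subr0.
  move=> r1; move: h2; rewrite x_0 r1 !add0r mulr1.
  by rewrite leNgt (mulr_gt0 (mulr_gt0 k0 k0) u0).
have E2' : A^T *m (b - A *m x2) = A^T *m f2 + g2.
  rewrite -E2; have -> : b - A *m x2 = (b - A *m x) + A *m (x - x2).
    by rewrite mulmxBr addrA subrK.
  by rewrite mulmxDr ne add0r.
have a0 : 0 < 6 * K * L * p * u.
  by rewrite !mulr_gt0 // (lt_le_trans ltr01) // (le_trans K1).
rewrite /backward_stable.
apply: (le_trans (backward_error_split a0 x20 E2' fb gb)).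
have F1 : 1 <= frobenius A.
  rewrite -sA; apply: sigma_max_le => // v; exact: enorm_mulmx_frobenius.
have -> : 12 * (6 * K * L * p * u) = (12 * 6 * 9 * 144) * p ^+ 14 * 1 * u.
  by rewrite KE LE; ring.
by rewrite ler_pM2r // ler_pM2l // !mulr_gt0 ?exprn_gt0.
Qed.
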